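(* Let $k$ be a field and let $(V,c)$ be a finite dimensional braided vector space over $k$ that is left triangular with respect to some totally ordered basis $X$. Identify $T(V)$ with $k\langle X\rangle$, let $I\subsetneq k\langle X\rangle$ be a braided biideal and let $v\in S_I$. Define the scalar $\gamma_{v,v}\in k$ by $d(v\otimes v)=\gamma_{v,v}\,v\otimes v$, where $d$ is (the extension to $T(V)\otimes T(V)$ of) the diagonal component of $c$. If $h:=h_I(v)<\infty$, then $\gamma_{v,v}$ is a root of unity. In this case let $t$ be the order of $\gamma_{v,v}$. If $\operatorname{char}k=0$, then $\gamma_{v,v}\neq1$ and $h=t$. If $\operatorname{char}k=p>0$, then $h=tp^l$ for some integer $l\geq 0$.
   Context: **Braidings.** A braided vector space $(V,c)$ is a vector space $V$ with an automorphism $c$ of $V\otimes V$ satisfying the braid equation $(c\otimes \mathrm{id})(\mathrm{id}\otimes c)(c\otimes \mathrm{id})=(\mathrm{id}\otimes c)(c\otimes \mathrm{id})(\mathrm{id}\otimes c)$. For an endomorphism $r$ of $V\otimes V$ define $r_{n,m}:V^{\otimes n}\otimes V^{\otimes m}\to V^{\otimes m}\otimes V^{\otimes n}$ by: identities if $n=0$ or $m=0$, $r_{1,1}=r$, $r_{1,m+1}=(\mathrm{id}_V\otimes r_{1,m})(r\otimes \mathrm{id}_{V^{\otimes m}})$, $r_{n+1,m}=(r_{n,m}\otimes \mathrm{id}_V)(\mathrm{id}_{V^{\otimes n}}\otimes r_{1,m})$. For $r=c$ these give a braiding on $T(V)$, again denoted $c$. $T(V)$ is a braided bialgebra with $\Delta:T(V)\to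 T(V)\underline{\otimes}T(V)$ and $\varepsilon$ the algebra morphisms with $\Delta(v)=1\otimes v+v\otimes 1$, $\varepsilon(v)=0$ for $v\in V$, where $T(V)\underline{\otimes}T(V)$ is $T(V)\otimes T(V)$ with multiplication $(m\otimes m)(\mathrm{id}\otimes c\otimes \mathrm{id})$. A braided biideal $I$ of $R=T(V)$ is an ideal and coideal with $c(R\otimes I+I\otimes R)=R\otimes I+I\otimes R$. **Left triangular.** For $V$ finite dimensional with totally ordered basis $X$, $c$ is left triangular with respect to $X$ if there are $\gamma_{x,y}\in k$ ($x,y\in X$) and $v_{x,y,z}\in V$ ($x,y,z\in X$, $z>y$) such that for all $x,y\in X$: $c(x\otimes y)=\gamma_{x,y}\,y\otimes x+\sum_{z>y} z\otimes v_{x,y,z}$. Its diagonal component is $d(x\otimes y)=\gamma_{x,y}\,y\otimes x$; on words $d(u\otimes w)=\gamma_{u,w}\,w\otimes u$, where $\gamma_{u,w}$ is the product of $\gamma_{x,y}$ over all letters $x$ of $u$ and $y$ of $w$ (with multiplicity). **Words.** $\langle X\rangle$ is the free monoid on $X$, $k\langle X\rangle=T(V)$ the free algebra, $l(u)$ the length of $u$. Lexicographical order: $u<v$ iff $u$ is a proper beginning of $v$, or $u=ras$, $v=rbt$ with $r,s,t\in\langle X\rangle$, $a,b\in X$, $a<b$. A word $u\ne1$ is Lyndon if $u<w$ for every factorization $u=vw$ with $v,w\neq1$. Standard order: $u\succeq v$ iff $l(u)<l(v)$, or $l(u)=l(v)$ and $u\ge v$ lexicographically; $\langle X\rangle_{\succ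 u}=\{w:w\succ u\}$. **PBW data.** $S_I=\{u\in\langle X\rangle: u \text{ Lyndon},\ u\notin k\langle X\rangle_{\succ u}+I\}$; for $u\in S_I$, $h_I(u)=\min\{t\in\mathbb N: u^t\in k\langle X\rangle_{\succ u^t}+I\}\in\{2,3,\dots,\infty\}$ ($\infty$ if there is no such $t$). *)

(* Defs.v *)
From HB Require Import structures.
From mathcomp Require Export all_boot all_order all_algebra finmap.
From mathcomp.multinomials Require Export monalg.

Set Implicit Arguments.
Unset Strict Implicit.
Unset Printing Implicit Defensive.

Import Order.TTheory Order.SeqLexiOrder.Exports GRing.Theory.

Local Open Scope ring_scope.

(* The vector space with basis A is the free module [{malg k[A]}]; the basis
   vector of a : A is [<< a >>].  So, for a basis X of V:
     V            is {malg k[X]},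
     V (x) V      is {malg k[X * X]},   x (x) y being << (x, y) >>,
     <X>          is {fmonom X},
     T(V) = k<X>  is the algebra {malg k[{fmonom X}]},
     T(V) (x) T(V) is {malg k[{fmonom X} * {fmonom X}]}. *)

Section FreeModules.
Context {k : fieldType}.
Implicit Types A B C D : choiceType.

Definition linext {A} {M : lmodType k} (f : A -> M) (a : {malg k[A]}) : M :=
  \sum_(i <- msupp a) a@_i *: f i.

Definition tens {A B} (a : {malg k[A]}) (b : {malg k[B]}) :
    {malg k[(A * B)%type]} :=
  linext (fun i => linext (fun j => << (i, j) >>) b) a.

Definition tensmap {A B C D} (f : {malg k[A]} -> {malg k[C]})
    (g : {malg k[B]} -> {malg k[D]}) :
    {malg k[(A * B)%type]} -> {malg k[(C * D)%type]} :=
  linext (fun p => tens (f << p.1 >>) (g << p.2 >>)).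

Definition assocr {A B C} :
    {malg k[(A * B * C)%type]} -> {malg k[(A * (B * C))%type]} :=
  linext (fun p => << (p.1.1, (p.1.2, p.2)) >>).

Definition assocl {A B C} :
    {malg k[(A * (B * C))%type]} -> {malg k[(A * B * C)%type]} :=
  linext (fun p => << (p.1, p.2.1, p.2.2) >>).

End FreeModules.

Section Braiding.
Context {k : fieldType} {X : choiceType}.
Implicit Types (c : {malg k[(X * X)%type]} -> {malg k[(X * X)%type]}).

Notation W := {fmonom X}.
Notation TV := {malg k[W]}.
Notation TVTV := {malg k[(W * W)%type]}.

Definition braid_left c :
    {malg k[(X * X * X)%type]} -> {malg k[(X * X * X)%type]} :=
  tensmap c id.

Definition braid_right c :
    {malg k[(X * X * X)%type]} -> {malg k[(X * X * X)%type]} :=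
  fun z => assocl (tensmap id c (assocr z)).

Definition braiding c : Prop :=
  bijective c /\
  forall z, braid_left c (braid_right c (braid_left c z))
          = braid_right c (braid_left c (braid_right c z)).

(* c_{1,m+1} = (id (x) c_{1,m}) (c (x) id) on x (x) w, with w of length m+1 *)
Fixpoint braid1 c (x : X) (w : seq X) : {malg k[(W * X)%type]} :=
  if w is y :: w' then
    linext (fun p : X * X =>
        linext (fun q : W * X => << (mmul (fmu p.1) q.1, q.2) >>)
          (braid1 c p.2 w'))
      (c << (x, y) >>)
  else << (mone, x) >>.

(* c_{n+1,m} = (c_{n,m} (x) id) (id (x) c_{1,m}) on u (x) w, with u of length
   n+1.  The recursion consumes u from its last letter: [ru] is u reversed. *)
Fixpoint braid_rev c (ru : seq X) (w : W) : TVTV :=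
  if ru is x :: ru' then
    linext (fun p : W * X =>
        linext (fun q : W * W => << (q.1, mmul q.2 (fmu p.2)) >>)
          (braid_rev c ru' p.1))
      (braid1 c x w)
  else << (w, mone) >>.

Definition braidT c : TVTV -> TVTV :=
  linext (fun p : W * W => braid_rev c (rev p.1) p.2).

(* (m (x) m) (id (x) c (x) id) *)
Definition bmul c (P Q : TVTV) : TVTV :=
  linext (fun p : W * W =>
      linext (fun q : W * W =>
          linext (fun r : W * W => << (mmul p.1 r.1, mmul r.2 q.2) >>)
            (braidT c << (p.2, q.1) >>))
        Q)
    P.

(* The algebra morphism for [bmul] with v |-> 1 (x) v + v (x) 1. *)
Definition comul c : TV -> TVTV :=
  linext (fun w : W =>
    foldr (fun x D => bmul c (tens 1 << fmu x >> + tens << fmu x >> 1) D)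
      (tens 1 1) w).

(* The algebra morphism vanishing on V: the coefficient of the empty word. *)
Definition counit (a : TV) : k := a@_mone.

(* R (x) I + I (x) R, for R = T(V) *)
Definition tens_ideal (I : TV -> Prop) (z : TVTV) : Prop :=
  exists2 s : seq (TV * TV),
    forall p, p \in s -> I p.1 \/ I p.2
    & z = \sum_(p <- s) tens p.1 p.2.

Record two_sided_ideal (I : TV -> Prop) : Prop := TwoSidedIdeal {
  tsi0 : I 0;
  tsiD : forall a b, I a -> I b -> I (a + b);
  tsiMl : forall a b, I b -> I (a * b);
  tsiMr : forall a b, I a -> I (a * b)
}.

Record coideal c (I : TV -> Prop) : Prop := Coideal {
  coideal_comul : forall a, I a -> tens_ideal I (comul c a);
  coideal_counit : forall a, I a -> counit a = 0
}.

Record braided_biideal c (I : TV -> Prop) : Prop := BraidedBiideal {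
  biideal_ideal : two_sided_ideal I;
  biideal_coideal : coideal c I;
  biideal_braid :
    forall z, tens_ideal I z <-> exists2 z', tens_ideal I z' & braidT c z' = z
}.

End Braiding.

Section Triangular.
Context {k : fieldType} {disp : Order.disp_t} {X : finOrderType disp}.

(* c is left triangular with respect to X, with diagonal component
   x (x) y |-> g x y *: (y (x) x). *)
Definition left_triangular
    (c : {malg k[(X * X)%type]} -> {malg k[(X * X)%type]})
    (g : X -> X -> k) : Prop :=
  exists vv : X -> X -> X -> {malg k[X]}, forall x y,
    c << (x, y) >>
    = g x y *: << (y, x) >> + \sum_(z : X | (y < z)%O) tens << z >> (vv x y z).

Definition gamma_word (g : X -> X -> k) (u w : {fmonom X}) : k :=
  \prod_(x <- (u : seq X)) \prod_(y <- (w : seq X)) g x y.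

Definition diagT (g : X -> X -> k) :
    {malg k[({fmonom X} * {fmonom X})%type]} ->
    {malg k[({fmonom X} * {fmonom X})%type]} :=
  linext (fun p => gamma_word g p.1 p.2 *: << (p.2, p.1) >>).

End Triangular.

Section Words.
Context {disp : Order.disp_t} {X : finOrderType disp}.
Implicit Types u v w : {fmonom X}.

Definition lex_lt u v : bool :=
  ((u : seqlexi X) < (v : seqlexi X))%O.

Definition lyndon u : Prop :=
  u <> mone /\
  forall v w, v <> mone -> w <> mone -> u = mmul v w -> lex_lt u w.

(* u succeeds v strictly in the standard order: shorter words are bigger. *)
Definition std_gt u v : bool :=
  (size u < size v)%N || ((size u == size v) && lex_lt v u).

Definition word_exp u (t : nat) : {fmonom X} := iter t (mmul u) mone.

End Words.

Section PBW.
Context {k : fieldType} {disp : Order.disp_t} {X : finOrderType disp}.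
Implicit Types (I : {malg k[{fmonom X}]} -> Prop) (u : {fmonom X}).

(* u lies in k<X>_{> u} + I, for > the strict standard order *)
Definition reducible I u : Prop :=
  exists a b : {malg k[{fmonom X}]},
    [/\ forall w, w \in msupp a -> std_gt w u, I b & << u >> = a + b].

Definition SI I u : Prop := lyndon u /\ ~ reducible I u.

(* h_I(u) = h for a finite h *)
Definition height_is I u (h : nat) : Prop :=
  reducible I (word_exp u h) /\
  forall t, reducible I (word_exp u t) -> (h <= t)%N.

End PBW.

(* Main.v *)
(* Words are compared in two ways: lexicographically, and by the relation
   [sgt], which asks for a first difference and is therefore stable under
   appending letters.  For each Lyndon word v = st the super-letter
   [v] = [s][t] - gamma_{t,s}^-1 [t][s] satisfies
     Delta [v] = [v] (x) 1 + 1 (x) [v]   modulo   span {u : u sgt v} (x) T(V),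
   because left triangularity makes c(u (x) w) equal to gamma_{u,w} w (x) u
   up to tensors with a greater left factor.  Hence, for Lyndon words
   l_1 >= ... >= l_r > v, modulo tensors whose left factor exceeds vvv...,
     Delta ([l_1]...[l_r][v]^n)
       = sum_i binom(n,i)_gamma gamma' [v]^i (x) [l_1]...[l_r][v]^(n-i).
   The words that are not leading words of I index a basis of k<X>/I, so there
   is a = [v]^h + sum alpha_w [w] in I with irreducible w succeeding v^h.
   As Delta a vanishes in k<X>/I (x) k<X>/I, evaluating it at suitable pairs of
   irreducible words shows first that no w ends in a Lyndon factor smaller
   than v and then, at v^i (x) v^(h-i), that binom(h,i)_gamma = 0 for
   0 < i < h.  By Gauss's formula prod_(j < h) (X - gamma^j) = X^h - 1, which
   forces gamma^h = 1 and determines h from the order of gamma. *)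
From HB Require Import structures.
Require Import Defs.
From mathcomp Require Import ring zify.
From Stdlib Require Import Classical ClassicalEpsilon.

Set Implicit Arguments.
Unset Strict Implicit.
Unset Printing Implicit Defensive.

Import Order.TTheory Order.SeqLexiOrder.Exports GRing.Theory.
Local Open Scope ring_scope.

(* Sealed, as a failing unification of two basis vectors would otherwise unfold
   finitely supported functions, at exponential cost. *)
HB.lock Definition bas {k : fieldType} {A : choiceType} (i : A) : {malg k[A]} :=
  << i >>.

HB.lock Definition lext {k : fieldType} {A : choiceType} {M : lmodType k}
    (f : A -> M) (a : {malg k[A]}) : M := linext f a.

HB.lock Definition tsr {k : fieldType} {A B : choiceType}
    (a : {malg k[A]}) (b : {malg k[B]}) : {malg k[(A * B)%type]} := tens a b.

(** * Free modules: linear extension, spans of basis vectors, tensors *)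

Section FreeModule.
Context {k : fieldType}.
Implicit Types A B : choiceType.

Lemma basE A (i : A) : << i >> = bas i :> {malg k[A]}.
Proof. by rewrite bas.unlock. Qed.

Lemma lextE A (M : lmodType k) (f : A -> M) : linext f = lext f.
Proof. by rewrite lext.unlock. Qed.

(** Linearity compares sums over three different supports; padding them with zero terms brings them
    to one index set. *)
Lemma lext_sub_sum A (M : lmodType k) (f : A -> M) (d : {fset A}) (a : {malg k[A]}) :
  (msupp a `<=` d)%fset -> lext f a = \sum_(i <- d) a@_i *: f i.
Proof.
move=> sad; rewrite -lextE /linext; apply/big_fset_incl => // i _ /mcoeff_outdom ->.
by rewrite scale0r.
Qed.

Lemma lext_is_linear A (M : lmodType k) (f : A -> M) : linear (lext f).
Proof.
move=> c a b.
pose d := (msupp (c *: a + b) `|` (msupp a `|` msupp b))%fset.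
have sd1 : (msupp (c *: a + b) `<=` d)%fset by rewrite fsubsetUl.
have sd2 : (msupp a `<=` d)%fset.
  by rewrite /d fsetUCA fsubsetUl.
have sd3 : (msupp b `<=` d)%fset.
  by rewrite /d fsetUA fsubsetUr.
rewrite (lext_sub_sum _ sd1) (lext_sub_sum _ sd2) (lext_sub_sum _ sd3).
rewrite scaler_sumr -big_split.
by apply: eq_bigr => i _; rewrite mcoeffD mcoeffZ scalerDl scalerA.
Qed.

HB.instance Definition _ A (M : lmodType k) (f : A -> M) :=
  GRing.isLinear.Build k {malg k[A]} M *:%R (lext f) (lext_is_linear f).

Lemma lextD A (M : lmodType k) (f : A -> M) a b :
  lext f (a + b) = lext f a + lext f b.
Proof. exact: linearD. Qed.

Lemma lextZ A (M : lmodType k) (f : A -> M) z a :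
  lext f (z *: a) = z *: lext f a.
Proof. exact: linearZ. Qed.

Lemma msupp_bas A (i : A) : msupp (bas i : {malg k[A]}) = [fset i]%fset.
Proof. by rewrite bas.unlock msuppU oner_eq0. Qed.

Lemma mcoeff_bas A (i j : A) : (bas i : {malg k[A]})@_j = (i == j)%:R.
Proof. by rewrite bas.unlock mcoeffU. Qed.

Lemma lext_sum A (M : lmodType k) (f : A -> M) a :
  lext f a = \sum_(i <- msupp a) a@_i *: f i.
Proof. by rewrite lext.unlock. Qed.

Lemma lextU A (M : lmodType k) (f : A -> M) i : lext f (bas i) = f i.
Proof. by rewrite lext_sum msupp_bas big_seq_fset1 mcoeff_bas eqxx scale1r. Qed.

Lemma eq_lext A (M : lmodType k) (f g : A -> M) a :
  f =1 g -> lext f a = lext g a.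
Proof. by move=> fg; rewrite !lext_sum; apply: eq_bigr => i _; rewrite fg. Qed.

Lemma lext_comp A (M N : lmodType k) (g : {linear M -> N}) (f : A -> M) a :
  g (lext f a) = lext (fun i => g (f i)) a.
Proof. by rewrite !lext_sum linear_sum; apply: eq_bigr => i _; rewrite linearZ. Qed.

Lemma lext_lext A B (M : lmodType k) (g : B -> M) (f : A -> {malg k[B]}) a :
  lext g (lext f a) = lext (fun i => lext g (f i)) a.
Proof. exact: lext_comp. Qed.

Lemma malgUZ A (c : k) (i : A) : << c *g i >> = c *: bas i :> {malg k[A]}.
Proof. by apply/malgP => j; rewrite bas.unlock mcoeffZ !mcoeffU mulrnAr mulr1. Qed.

Lemma malg_sum_bas A (a : {malg k[A]}) : a = \sum_(i <- msupp a) a@_i *: bas i.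
Proof.
by rewrite {1}(monalgE a); apply: eq_bigr => i _; rewrite malgUZ.
Qed.

Lemma lext_id A (a : {malg k[A]}) : lext (fun i => bas i) a = a.
Proof. by rewrite lext_sum [RHS]malg_sum_bas. Qed.

(** Interchange of finite sums; later it commutes crossings that act on disjoint strands. *)
Lemma lext_exch A B (M : lmodType k) (F : A -> B -> M) a b :
  lext (fun i => lext (F i) b) a = lext (fun j => lext (F^~ j) a) b.
Proof.
rewrite !lext_sum; under eq_bigr do rewrite lext_sum scaler_sumr.
rewrite exchange_big; apply: eq_bigr => j _; rewrite lext_sum scaler_sumr.
by apply: eq_bigr => i _; rewrite !scalerA mulrC.
Qed.

Lemma lext_funD A (M : lmodType k) (f g : A -> M) a :
  lext (fun i => f i + g i) a = lext f a + lext g a.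
Proof. by rewrite !lext_sum -big_split; apply: eq_bigr => i _; rewrite scalerDr. Qed.

Lemma lext_funZ A (M : lmodType k) (c : k) (f : A -> M) a :
  lext (fun i => c *: f i) a = c *: lext f a.
Proof.
by rewrite !lext_sum scaler_sumr; apply: eq_bigr => i _; rewrite !scalerA mulrC.
Qed.

(** Membership in the span of a set of basis vectors, phrased through the support. All statements on
    leading terms and error terms take this form. *)
Definition spanned A (P : A -> Prop) (a : {malg k[A]}) : Prop :=
  forall i, i \in msupp a -> P i.

Lemma spanned0 A (P : A -> Prop) : spanned P 0.
Proof. by move=> i; rewrite msupp0 in_fset0. Qed.

Lemma spannedD A (P : A -> Prop) a b :
  spanned P a -> spanned P b -> spanned P (a + b).
Proof.
by move=> Pa Pb i /(fsubsetP (msuppD_le _ _)); rewrite in_fsetU => /orP[/Pa|/Pb].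
Qed.

Lemma spannedZ A (P : A -> Prop) c a : spanned P a -> spanned P (c *: a).
Proof. by move=> Pa i /(fsubsetP (msuppZ_le _ _)) /Pa. Qed.

Lemma spannedN A (P : A -> Prop) a : spanned P a -> spanned P (- a).
Proof. by move=> Pa i; rewrite msuppN => /Pa. Qed.

Lemma spannedB A (P : A -> Prop) a b :
  spanned P a -> spanned P b -> spanned P (a - b).
Proof. by move=> Pa Pb; apply: spannedD => //; apply: spannedN. Qed.

Lemma spannedU A (P : A -> Prop) i : P i -> spanned P (bas i).
Proof. by move=> Pi j; rewrite msupp_bas in_fset1 => /eqP->. Qed.

Lemma spanned_sum A (P : A -> Prop) (J : eqType) (r : seq J) (Q : pred J) F :
  (forall j, j \in r -> Q j -> spanned P (F j)) ->
  spanned P (\sum_(j <- r | Q j) F j).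
Proof.
move=> PF; rewrite big_seq_cond; apply: (big_ind (spanned P)) => [||j].
- exact: spanned0.
- by move=> *; apply: spannedD.
- by case/andP; apply: PF.
Qed.

Lemma sub_spanned A (P Q : A -> Prop) a :
  (forall i, P i -> Q i) -> spanned P a -> spanned Q a.
Proof. by move=> PQ Pa i /Pa /PQ. Qed.

Lemma spanned_lext A B (P : A -> Prop) (Q : B -> Prop) (f : A -> {malg k[B]}) a :
  spanned P a -> (forall i, P i -> spanned Q (f i)) -> spanned Q (lext f a).
Proof.
move=> Pa Qf; rewrite lext_sum.
by apply: spanned_sum => i /Pa /Qf h _; apply: spannedZ.
Qed.

Lemma spannedT A (a : {malg k[A]}) : spanned (fun=> True) a.
Proof. by []. Qed.

Lemma lextB_spanned A B (P : A -> Prop) (Q : B -> Prop)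
    (f g : A -> {malg k[B]}) a :
  spanned P a -> (forall i, P i -> spanned Q (f i - g i)) ->
  spanned Q (lext f a - lext g a).
Proof.
move=> Pa Qfg; rewrite !lext_sum -sumrB; apply: spanned_sum => i /Pa /Qfg h _.
by rewrite -scalerBr; apply: spannedZ.
Qed.

Lemma tsrE A B (a : {malg k[A]}) (b : {malg k[B]}) :
  tsr a b = lext (fun i => lext (fun j => bas (i, j)) b) a.
Proof. by rewrite tsr.unlock /tens lext.unlock bas.unlock. Qed.

Lemma tensE A B (a : {malg k[A]}) (b : {malg k[B]}) : tens a b = tsr a b.
Proof. by rewrite tsr.unlock. Qed.

Lemma tsrU A B (i : A) (j : B) : tsr (bas i) (bas j) = bas (i, j) :> {malg k[_]}.
Proof. by rewrite tsrE !lextU. Qed.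

Lemma lext_tsr A B (M : lmodType k) (F : A * B -> M) a b :
  lext F (tsr a b) = lext (fun i => lext (fun j => F (i, j)) b) a.
Proof.
rewrite tsrE lext_lext; apply: eq_lext => i.
by rewrite lext_lext; apply: eq_lext => j; rewrite lextU.
Qed.

Lemma tsrDl A B (a a' : {malg k[A]}) (b : {malg k[B]}) :
  tsr (a + a') b = tsr a b + tsr a' b.
Proof. by rewrite !tsrE linearD. Qed.

Lemma tsrZl A B c (a : {malg k[A]}) (b : {malg k[B]}) :
  tsr (c *: a) b = c *: tsr a b.
Proof. by rewrite !tsrE linearZ. Qed.

Lemma tsrC A B (a : {malg k[A]}) (b : {malg k[B]}) :
  tsr a b = lext (fun j => lext (fun i => bas (i, j)) a) b.
Proof. by rewrite tsrE lext_exch. Qed.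

Lemma tsrDr A B (a : {malg k[A]}) (b b' : {malg k[B]}) :
  tsr a (b + b') = tsr a b + tsr a b'.
Proof. by rewrite !(tsrC a) linearD. Qed.

Lemma tsrZr A B c (a : {malg k[A]}) (b : {malg k[B]}) :
  tsr a (c *: b) = c *: tsr a b.
Proof. by rewrite !(tsrC a) linearZ. Qed.

Lemma tsrBZl A B (a a' : {malg k[A]}) z (b : {malg k[B]}) :
  tsr (a - z *: a') b = tsr a b - z *: tsr a' b.
Proof. by rewrite -scaleNr tsrDl tsrZl scaleNr. Qed.

Lemma tsrBZr A B (a : {malg k[A]}) z (b b' : {malg k[B]}) :
  tsr a (b - z *: b') = tsr a b - z *: tsr a b'.
Proof. by rewrite -scaleNr tsrDr tsrZr scaleNr. Qed.

Lemma spanned_tsr A B (P : A -> Prop) (Q : B -> Prop) a b :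
  spanned P a -> spanned Q b -> spanned (fun p => P p.1 /\ Q p.2) (tsr a b).
Proof.
move=> Pa Qb; rewrite tsrE; apply: (spanned_lext Pa) => i Pi.
by apply: (spanned_lext Qb) => j Qj; apply: spannedU.
Qed.

End FreeModule.

(** * The free algebra on words *)

Section WordAlgebra.
Context {k : fieldType} {X : choiceType}.
Notation W := {fmonom X}.
Notation TV := {malg k[W]}.

Lemma malgM_lext (a b : TV) :
  a * b = lext (fun u => lext (fun w => bas (mmul u w)) b) a.
Proof.
rewrite malgME lext_sum; apply: eq_bigr => u _; rewrite lext_sum scaler_sumr.
by apply: eq_bigr => w _; rewrite scalerA -malgUZ.
Qed.

Lemma malgMUU (u w : W) : bas u * bas w = bas (mmul u w) :> TV.
Proof. by rewrite malgM_lext !lextU. Qed.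

Lemma malg1U : 1 = bas mone :> TV.
Proof. by rewrite bas.unlock. Qed.

Lemma lext_mul (M : lmodType k) (F : W -> M) (a b : TV) :
  lext F (a * b) = lext (fun u => lext (fun w => F (mmul u w)) b) a.
Proof.
rewrite malgM_lext lext_lext; apply: eq_lext => u.
by rewrite lext_lext; apply: eq_lext => w; rewrite lextU.
Qed.

Lemma spanned_mul (P Q R : W -> Prop) (a b : TV) :
  spanned P a -> spanned Q b -> (forall u w, P u -> Q w -> R (mmul u w)) ->
  spanned R (a * b).
Proof.
move=> Pa Qb PQR; rewrite malgM_lext.
apply: (spanned_lext Pa) => u Pu; apply: (spanned_lext Qb) => w Qw.
by apply: spannedU; apply: PQR.
Qed.

Lemma word_eqP (u w : W) : u = w :> seq X -> u = w.
Proof. by move=> uw; apply/eqP; rewrite fmP uw. Qed.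

Lemma wordM (u w : W) : mmul u w = u ++ w :> seq X.
Proof. exact: fmM. Qed.

Lemma wordU (x : X) : fmu x = [:: x] :> seq X.
Proof. exact: fmU. Qed.

Lemma word1 : (mone : W) = [::] :> seq X.
Proof. exact: fm1. Qed.

End WordAlgebra.

(** * The braided product on the tensor square of T(V), and the coproduct *)

HB.lock Definition cross {k : fieldType} {X : choiceType}
    (c : {malg k[(X * X)%type]} -> {malg k[(X * X)%type]}) (u w : {fmonom X}) :
    {malg k[({fmonom X} * {fmonom X})%type]} := braid_rev c (rev u) w.

HB.lock Definition tmul {k : fieldType} {X : choiceType}
    (c : {malg k[(X * X)%type]} -> {malg k[(X * X)%type]})
    (P Q : {malg k[({fmonom X} * {fmonom X})%type]}) := bmul c P Q.

HB.lock Definition delta {k : fieldType} {X : choiceType}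
    (c : {malg k[(X * X)%type]} -> {malg k[(X * X)%type]})
    (a : {malg k[{fmonom X}]}) := comul c a.

Section TensorSquare.
Context {k : fieldType} {X : choiceType}.
Variable c : {malg k[(X * X)%type]} -> {malg k[(X * X)%type]}.
Notation W := {fmonom X}.
Notation TV := {malg k[W]}.
Notation TVTV := {malg k[(W * W)%type]}.
Implicit Types (u w : W) (a b : TV) (P Q R : TVTV).

Lemma crossE u w : braidT c (bas (u, w)) = cross c u w.
Proof. by rewrite /braidT lextE lextU cross.unlock. Qed.

Lemma cross1l w : cross c mone w = bas (w, mone).
Proof. by rewrite cross.unlock word1 bas.unlock. Qed.

Lemma braid1_nil x : braid1 c x [::] = bas (mone, x).
Proof. by rewrite bas.unlock. Qed.

Lemma braid1_cons x y (s : seq X) :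
  braid1 c x (y :: s) =
  lext (fun p : X * X =>
      lext (fun q : W * X => bas (mmul (fmu p.1) q.1, q.2)) (braid1 c p.2 s))
    (c (bas (x, y))).
Proof. by rewrite lext.unlock bas.unlock. Qed.

Lemma cross_rcons u x w :
  cross c (mmul u (fmu x)) w =
  lext (fun p : W * X =>
      lext (fun q : W * W => bas (q.1, mmul q.2 (fmu p.2))) (cross c u p.1))
    (braid1 c x w).
Proof. by rewrite cross.unlock wordM wordU rev_cat /= lext.unlock bas.unlock. Qed.

(** Appending on the right matches the recursion of [braid_rev], which peels off the last letter. *)
Lemma word_ind (K : W -> Prop) :
  K mone -> (forall u x, K u -> K (mmul u (fmu x))) -> forall u, K u.
Proof.
move=> K1 Kr u; rewrite -[u]fmK; elim/last_ind: {u}(u : seq X) => [|s x IH].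
  by rewrite -fmoneE.
suff -> : FMonom (rcons s x) = mmul (FMonom s) (fmu x) by apply: Kr.
by apply: word_eqP; rewrite wordM wordU cats1.
Qed.

Lemma cross1r u : cross c u mone = bas (mone, u).
Proof.
elim/word_ind: u => [|u x IH]; first by rewrite cross1l.
by rewrite cross_rcons word1 braid1_nil lextU /= IH lextU /=.
Qed.

Lemma braid1_cat x (s1 s2 : seq X) :
  braid1 c x (s1 ++ s2) =
  lext (fun p : W * X =>
      lext (fun q : W * X => bas (mmul p.1 q.1, q.2)) (braid1 c p.2 s2))
    (braid1 c x s1).
Proof.
elim: s1 x => [|y s1 IH] x.
  rewrite braid1_nil lextU /= -[LHS]lext_id; apply: eq_lext => -[u z] /=.
  by rewrite mul1m.
rewrite cat_cons !braid1_cons lext_lext; apply: eq_lext => p; rewrite IH !lext_lext.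
apply: eq_lext => q; rewrite lextU lext_lext /=.
by apply: eq_lext => r; rewrite lextU /= mulmA.
Qed.

(* The hexagon identities hold for an arbitrary map [c]: they only reorder
   independent crossings. *)
Lemma cross_mull u1 u2 w :
  cross c (mmul u1 u2) w =
  lext (fun p : W * W =>
      lext (fun q : W * W => bas (q.1, mmul q.2 p.2)) (cross c u1 p.1))
    (cross c u2 w).
Proof.
elim/word_ind: u2 w => [|u2 x IH] w.
  rewrite mulm1 cross1l lextU /= -[LHS]lext_id.
  by apply: eq_lext => -[? ?] /=; rewrite mulm1.
rewrite mulmA !cross_rcons lext_lext; apply: eq_lext => p.
rewrite IH !lext_lext; apply: eq_lext => q.
rewrite lextU lext_lext /=.
by apply: eq_lext => r; rewrite lextU /= mulmA.
Qed.

Lemma cross_mulr u w1 w2 :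
  cross c u (mmul w1 w2) =
  lext (fun p : W * W =>
      lext (fun q : W * W => bas (mmul p.1 q.1, q.2)) (cross c p.2 w2))
    (cross c u w1).
Proof.
elim/word_ind: u w1 w2 => [|u x IH] w1 w2.
  by rewrite !cross1l lextU /= cross1l lextU /=.
rewrite !cross_rcons wordM braid1_cat !lext_lext.
apply: eq_lext => p; rewrite !lext_lext.
under eq_lext => q do rewrite lextU /= IH lext_lext.
(* The crossing of [u] with [p.1] and that of [p.2] with [w2] involve disjoint strands, so they
   commute. *)
rewrite lext_exch; apply: eq_lext => q.
rewrite lextU /= cross_rcons !lext_lext; apply: eq_lext => r.
rewrite !lext_lext; apply: eq_lext => s.
by rewrite !lextU /=.
Qed.

Lemma tmulE P Q :
  tmul c P Q =
  lext (fun p : W * W => lext (fun q : W * W =>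
    lext (fun r : W * W => bas (mmul p.1 r.1, mmul r.2 q.2))
      (cross c p.2 q.1)) Q) P.
Proof.
rewrite tmul.unlock /bmul lextE; apply: eq_lext => p; rewrite lextE.
apply: eq_lext => q; rewrite lextE basE crossE.
by apply: eq_lext => r; rewrite basE.
Qed.

Lemma tmul_is_linear P : linear (tmul c P).
Proof.
move=> z Q Q'; rewrite !tmulE -lext_funZ -lext_funD.
by apply: eq_lext => p; rewrite linearP.
Qed.

HB.instance Definition _ P :=
  GRing.isLinear.Build k TVTV TVTV *:%R (tmul c P) (tmul_is_linear P).

Lemma tmulDl P P' Q : tmul c (P + P') Q = tmul c P Q + tmul c P' Q.
Proof. by rewrite !tmulE linearD. Qed.

Lemma tmulBl P P' Q : tmul c (P - P') Q = tmul c P Q - tmul c P' Q.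
Proof. by rewrite !tmulE linearB. Qed.

Lemma tmulZl z P Q : tmul c (z *: P) Q = z *: tmul c P Q.
Proof. by rewrite !tmulE linearZ. Qed.

(** By the hexagon identities both sides consist of the same crossings: right factor of [P] with
    left factor of [Q], right factor of [Q] with left factor of [R], then what remains of [P] with
    what remains of [R]. *)
Lemma tmulA P Q R : tmul c P (tmul c Q R) = tmul c (tmul c P Q) R.
Proof.
rewrite !tmulE lext_lext; apply: eq_lext => p.
rewrite !lext_lext; apply: eq_lext => q.
rewrite !lext_lext.
under [RHS]eq_lext => r do rewrite lextU /=.
rewrite lext_exch; apply: eq_lext => s.
rewrite lext_lext /=.
under eq_lext => t do rewrite lextU /= cross_mulr lext_lext.
rewrite lext_exch; apply: eq_lext => r.
rewrite cross_mull lext_lext; apply: eq_lext => t.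
rewrite !lext_lext; apply: eq_lext => z.
by rewrite !lextU /= !mulmA.
Qed.

Lemma tmul1l Q : tmul c (tsr 1 1) Q = Q.
Proof.
rewrite malg1U tsrU tmulE lextU -[RHS]lext_id.
apply: eq_lext => -[u w] /=.
by rewrite cross1l lextU /= !mul1m.
Qed.

Lemma tmul_tsrl a Q :
  tmul c (tsr a 1) Q =
  lext (fun u => lext (fun q : W * W => bas (mmul u q.1, q.2)) Q) a.
Proof.
rewrite tmulE malg1U lext_tsr; apply: eq_lext => u.
rewrite lextU /=; apply: eq_lext => q.
by rewrite cross1l lextU /= mul1m.
Qed.

Lemma tmul_tsrr P b :
  tmul c P (tsr 1 b) =
  lext (fun p : W * W => lext (fun w => bas (p.1, mmul p.2 w)) b) P.
Proof.
rewrite tmulE; apply: eq_lext => p.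
rewrite malg1U lext_tsr lextU; apply: eq_lext => w /=.
by rewrite cross1r lextU /= mulm1.
Qed.

(** Both multiplications only cross the empty word, so the twisted product is the naive one here. *)
Lemma tmul_tsr a b a' b' :
  tmul c (tsr a 1) (tmul c (tsr a' b') (tsr 1 b)) = tsr (a * a') (b' * b).
Proof.
rewrite tmul_tsrr tmul_tsrl [in RHS]tsrE lext_mul; apply: eq_lext => u.
rewrite lext_lext lext_tsr; apply: eq_lext => u'.
rewrite lext_mul; apply: eq_lext => w'; rewrite lext_lext.
by apply: eq_lext => w; rewrite lextU.
Qed.

Lemma tmul_ll a a' b : tmul c (tsr a 1) (tsr a' b) = tsr (a * a') b.
Proof. by rewrite -[in RHS](mulr1 b) -tmul_tsr tmul_tsrr; congr tmul;
  rewrite -[LHS]lext_id; apply: eq_lext => -[u w]; rewrite malg1U lextU mulm1. Qed.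

Lemma tmul_rr a b b' : tmul c (tsr a b) (tsr 1 b') = tsr a (b * b').
Proof. by rewrite -[in RHS](mul1r a) -tmul_tsr tmulA tmul_ll mul1r. Qed.

Lemma tmul_lr a b : tmul c (tsr a 1) (tsr 1 b) = tsr a b.
Proof. by rewrite tmul_ll mulr1. Qed.

Lemma tmul1r Q : tmul c Q (tsr 1 1) = Q.
Proof.
rewrite tmul_tsrr -[RHS]lext_id; apply: eq_lext => -[u w].
by rewrite malg1U lextU mulm1.
Qed.

Definition delta_word (s : seq X) : TVTV :=
  foldr (fun x D => tmul c (tsr 1 (bas (fmu x)) + tsr (bas (fmu x)) 1) D)
    (tsr 1 1) s.

Lemma deltaE a : delta c a = lext (fun w : W => delta_word w) a.
Proof.
rewrite delta.unlock /comul lextE; apply: eq_lext => w.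
by elim: (w : seq X) => [|x s IH] /=; rewrite ?IH !tensE ?basE ?tmul.unlock.
Qed.

Lemma delta_is_linear : linear (delta c).
Proof. by move=> z a b; rewrite !deltaE linearP. Qed.

HB.instance Definition _ :=
  GRing.isLinear.Build k TV TVTV *:%R (delta c) delta_is_linear.

Lemma delta1 : delta c 1 = tsr 1 1.
Proof. by rewrite [in LHS]malg1U deltaE lextU word1. Qed.

Lemma delta_letter x :
  delta c (bas (fmu x)) = tsr 1 (bas (fmu x)) + tsr (bas (fmu x)) 1.
Proof. by rewrite deltaE lextU wordU /= tmul1r. Qed.

(** On words [delta] is a product over letters, so associativity of [tmul] splits it at any
    point. *)
Lemma deltaM a b : delta c (a * b) = tmul c (delta c a) (delta c b).
Proof.
rewrite malgM_lext !deltaE tmulE lext_lext !lext_lext.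
apply: eq_lext => u; rewrite lext_lext.
transitivity (tmul c (delta_word u) (lext (fun w : W => delta_word w) b)).
  rewrite lext_comp; apply: eq_lext => w; rewrite lextU wordM.
  elim: (u : seq X) => [|x s IH]; first by rewrite /= tmul1l.
  by rewrite /= IH tmulA.
by rewrite tmulE.
Qed.

End TensorSquare.

(** * Orders on sequences, Lyndon words and their factorizations *)

Section Words.
Context {disp : Order.disp_t} {X : finOrderType disp}.
Implicit Types (x y : X) (r s t a b : seq X) (ls : seq (seq X)).

Definition lexlt s t : bool := ((s : seqlexi X) < (t : seqlexi X))%O.
Definition lexle s t : bool := ((s : seqlexi X) <= (t : seqlexi X))%O.

(* [s] and [t] differ before either ends, and [s] is greater there; unlike the
   lexicographic order this is stable under appending letters. *)
Fixpoint sgt s t : bool :=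
  if s is x :: s' then
    if t is y :: t' then (y < x)%O || (x == y) && sgt s' t' else false
  else false.

Definition word_pow s m := flatten (nseq m s).

Lemma sgt_cat s t a b : sgt s t -> sgt (s ++ a) (t ++ b).
Proof.
elim: s t => [|x s IH] [|y t] //=; case: (y < x)%O => //=.
by case/andP => -> /IH.
Qed.

Lemma sgt_catr s t a : sgt s t -> sgt (s ++ a) t.
Proof. by rewrite -[X in _ -> sgt _ X]cats0; apply: sgt_cat. Qed.

Lemma sgt_catrr s t b : sgt s t -> sgt s (t ++ b).
Proof. by rewrite -[X in _ -> sgt X _]cats0; apply: sgt_cat. Qed.

Lemma sgt_cat2l r s t : sgt (r ++ s) (r ++ t) = sgt s t.
Proof. by elim: r => //= x r ->; rewrite ltxx eqxx. Qed.

Lemma sgt_trans s t r : sgt s t -> sgt t r -> sgt s r.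
Proof.
elim: s t r => [|x s IH] [|y t] [|z r] //=.
case/orP => [yx|/andP[/eqP <- st]].
  case/orP => [zy|/andP[/eqP <- tr]]; first by rewrite (lt_trans zy yx).
  by rewrite yx.
case/orP => [->//|/andP[-> tr]]; by rewrite (IH _ _ st tr) orbT.
Qed.

Lemma sgt_irr s : sgt s s = false.
Proof. by elim: s => //= x s ->; rewrite ltxx andbF. Qed.

Lemma lexlt_cons x s y t :
  lexlt (x :: s) (y :: t) = (x < y)%O || (x == y) && lexlt s t.
Proof.
rewrite /lexlt ltxi_cons; case: (ltgtP x y) => //= _.
Qed.

Lemma sgt_lexlt s t : sgt s t -> lexlt t s.
Proof.
elim: s t => [|x s IH] [|y t] //=; rewrite lexlt_cons eq_sym.
by case/orP => [->//|/andP[-> /IH ->]]; rewrite orbT.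
Qed.

Lemma lexltP s t :
  lexlt s t -> sgt t s \/ exists2 r, t = s ++ r & r <> [::].
Proof.
elim: s t => [|x s IH] [|y t] //=; first by right; exists (y :: t).
rewrite lexlt_cons; case/orP => [->|/andP[/eqP-> /IH [->|[r -> r0]]]].
- by left.
- by left; rewrite eqxx orbT.
- by right; exists r.
Qed.

Lemma lexlt_sgt s t : (size t <= size s)%N -> lexlt s t -> sgt t s.
Proof.
move=> st /lexltP [//|[r tE r0]]; case: r tE r0 => // x r tE _.
by move: st; rewrite tE size_cat addnS ltnNge leq_addr.
Qed.

Lemma lexlt_irr s : lexlt s s = false.
Proof. exact: ltxx. Qed.

Lemma lexlt_trans s t r : lexlt s t -> lexlt t r -> lexlt s r.
Proof. exact: lt_trans. Qed.

Lemma lexlt_catr s r : r <> [::] -> lexlt s (s ++ r).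
Proof.
move=> r0; elim: s => [|x s IH]; first by case: r r0.
by rewrite lexlt_cons eqxx IH orbT.
Qed.

Lemma lexleNlt s t : lexle s t = ~~ lexlt t s.
Proof. exact: leNgt. Qed.

Lemma lexle_trans s t r : lexle s t -> lexle t r -> lexle s r.
Proof. exact: le_trans. Qed.

Lemma lexle_eqVlt s t : lexle s t = (s == t) || lexlt s t.
Proof. exact: le_eqVlt. Qed.

Lemma sgt_take s t b : (size s <= size t)%N -> sgt s (t ++ b) -> sgt s t.
Proof.
elim: s t => [|x s IH] [|y t] //= st; case: (y < x)%O => //=.
by case/andP => -> /IH ->.
Qed.

Definition lyn s := s <> [::] /\
  forall a b, a <> [::] -> b <> [::] -> s = a ++ b -> sgt b s.

(** A proper suffix is shorter than the word and cannot extend it, so the lexicographic inequality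
    is witnessed by a first difference. *)
Lemma lyn_lyndon (u : {fmonom X}) : lyndon u -> lyn u.
Proof.
case=> u1 uL; split=> [u0|a b a0 b0 uE].
  by apply: u1; apply: word_eqP; rewrite word1.
have nz s : s <> [::] -> FMonom s <> mone.
  by move=> s0 /(congr1 (@fmonom_val _)); rewrite word1.
apply: lexlt_sgt; first by rewrite uE size_cat leq_addl.
apply: (uL (FMonom a) (FMonom b)) (nz _ a0) (nz _ b0) _.
by apply: word_eqP; rewrite wordM.
Qed.

Lemma lyn1 x : lyn [:: x].
Proof.
split=> // -[|y a] // [|z b] // _ _ /(congr1 size) /=.
by rewrite size_cat /= addnS.
Qed.

(** If [s] is not a prefix of [t], the first difference of [s] and [t] decides. If t = s r,
    cancelling [s] leaves r against t, and r is a proper suffix of the Lyndon word [t]. *)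
Lemma sgt_merge s t : lyn s -> lyn t -> lexlt s t -> sgt t (s ++ t).
Proof.
move=> sL [t0 tL] /lexltP [ts|[r tE r0]]; first exact: sgt_catrr.
by rewrite {1}tE sgt_cat2l; apply: tL tE => //; case: sL.
Qed.

Lemma cat_split (s t a b : seq X) : s ++ t = a ++ b ->
  (exists r, s = a ++ r /\ b = r ++ t) \/
  (exists2 r, r <> [::] & a = s ++ r /\ t = r ++ b).
Proof.
elim: s a => [|x s IH] [|y a] /=.
- by move=> ->; left; exists [::].
- by move=> ->; right; exists (y :: a).
- by move=> <-; left; exists (x :: s).
by case=> -> /IH [[r [-> ->]]|[r r0 [-> ->]]]; [left|right]; exists r.
Qed.

(** A proper suffix of s t that is properly contained in [t] exceeds [t], which exceeds s t by
    [sgt_merge]. A longer one is r t with r a proper suffix of [s], and r already differs from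
    [s]. *)
Lemma lyn_merge s t : lyn s -> lyn t -> lexlt s t -> lyn (s ++ t).
Proof.
move=> sL tL st; have tst := sgt_merge sL tL st.
split=> [|a b a0 b0 /cat_split]; first by case: s sL {st tst} => [[]|].
case=> [[r [sE bE]]|[r r0 [_ tE]]]; last first.
  by apply: sgt_trans tst; apply: tL.2 r0 b0 tE.
have [r0|r0] := eqVneq r [::]; first by rewrite bE r0.
rewrite bE; apply: sgt_cat; apply: sL.2 a0 _ sE; exact/eqP.
Qed.

Lemma word_powS s m : word_pow s m.+1 = s ++ word_pow s m.
Proof. by []. Qed.

Lemma word_powD s m n : word_pow s (m + n) = word_pow s m ++ word_pow s n.
Proof. by rewrite /word_pow nseqD flatten_cat. Qed.

Lemma size_word_pow s m : size (word_pow s m) = (m * size s)%N.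
Proof. by elim: m => // m IH; rewrite word_powS size_cat IH mulSn. Qed.

(* [t] exceeds the infinite word sss... *)
Definition sgt_inf s t := exists m, sgt t (word_pow s m).

Lemma sgt_inf_pow s t : sgt t s -> sgt_inf s t.
Proof. by exists 1; rewrite /word_pow /= cats0. Qed.

Lemma sgt_inf_powm s t m : sgt t (word_pow s m) -> sgt_inf s t.
Proof. by exists m. Qed.

Lemma sgt_inf_trans s t r : sgt r t -> sgt_inf s t -> sgt_inf s r.
Proof. by move=> rt [m tm]; exists m; apply: sgt_trans tm. Qed.

Lemma sgt_inf_catr s t r : sgt_inf s t -> sgt_inf s (t ++ r).
Proof. by case=> m tm; exists m; apply: sgt_catr. Qed.

Lemma sgt_inf_catl s t : sgt_inf s t -> sgt_inf s (s ++ t).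
Proof. by case=> m tm; exists m.+1; rewrite word_powS sgt_cat2l. Qed.

(** The first difference lies within the length of [t], so every power of [s] at least that long
    detects it. *)
Lemma sgt_inf_size s t m :
  sgt_inf s t -> (size t <= m * size s)%N -> sgt t (word_pow s m).
Proof.
case=> n tn tm; have [mn|/ltnW nm] := leqP m n.
  apply: (@sgt_take _ _ (word_pow s (n - m))); first by rewrite size_word_pow.
  by rewrite -word_powD subnKC.
by rewrite -(subnKC nm) word_powD; apply: sgt_catrr.
Qed.

(** The delicate case is l = s r: the suffix r exceeds s r, and iterating this, r exceeds every
    s...s r. *)
Lemma lyn_sgt_inf s l : lyn s -> lyn l -> lexlt s l -> sgt_inf s l.
Proof.
move=> [s0 _] [l0 lL] /lexltP [|[r lE r0]]; first exact: sgt_inf_pow.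
have rl : sgt r (s ++ r) by rewrite -lE; apply: lL lE.
have sr n : sgt r (word_pow s n.+1 ++ r).
  elim: n => [|n IH]; first by rewrite /word_pow /= cats0.
  by apply: (sgt_trans rl); rewrite word_powS -catA sgt_cat2l.
have {}sr : sgt r (word_pow s (size r).+1).
  apply: sgt_take (sr _); rewrite size_word_pow.
  case: (s) s0 => // x s' _ /=; rewrite mulnS; exact: leq_trans (leqnSn _) (leq_addr _ _).
by rewrite lE; apply: sgt_inf_catl; exists (size r).+1.
Qed.

Definition lexge s t := lexle t s.

Section Factor.
Variable P : seq X -> Prop.
Hypothesis P1 : forall x, P [:: x].
Hypothesis PM : forall s t, lyn s -> lyn t -> P s -> P t -> lexlt s t -> P (s ++ t).

(** A Lyndon word smaller than the head is merged with it, and the merged word is inserted into the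
    tail. Carrying [P] along turns the factorization algorithm into an induction principle. *)
Lemma lyn_insert ls l :
  (forall s, s \in ls -> lyn s /\ P s) -> sorted lexge ls -> lyn l -> P l ->
  exists ls', [/\ flatten ls' = l ++ flatten ls,
    forall s, s \in ls' -> lyn s /\ P s & sorted lexge ls'].
Proof.
elim: ls l => [|s ls IH] l lsP lss lL Pl.
  by exists [:: l]; split=> // s; rewrite inE => /eqP->.
have [lt_ls|] := boolP (lexlt l s); last first.
  rewrite -lexleNlt => sl; exists [:: l, s & ls]; split=> //=.
    by move=> t; rewrite inE => /predU1P[->//|/lsP].
  by rewrite {1}/lexge sl.
have [sL Ps] := lsP s (mem_head _ _).
have [||||ls' [lsE ls'P ss]] := IH (l ++ s).
- by move=> t tls; apply: lsP; rewrite inE tls orbT.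
- exact: path_sorted lss.
- exact: lyn_merge.
- exact: PM.
by exists ls'; split=> //; rewrite lsE -catA.
Qed.

Lemma lyn_factor s : exists ls, [/\ flatten ls = s,
    forall t, t \in ls -> lyn t /\ P t & sorted lexge ls].
Proof.
elim: s => [|x s [ls [<- lsP lss]]]; first by exists [::].
exact: (@lyn_insert ls [:: x] lsP lss (lyn1 x) (P1 x)).
Qed.

(** The nonincreasing factorization of a Lyndon word [s] has one factor. Otherwise the first factor
    l is a proper prefix, so l < s, and the last factor l' is a proper suffix, so s < l', against l'
    <= l. *)
Lemma lyn_P s : lyn s -> P s.
Proof.
move=> [s0 sL]; have [ls [lsE lsP lss]] := lyn_factor s.
case: ls => [|l ls] in lsE lsP lss *; first by case: s0.
case/lastP: ls => [|ls l'] in lsE lsP lss *.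
  by rewrite -lsE /= cats0; case: (lsP l (mem_head _ _)).
have l'l : lexle l' l.
  have := order_path_min _ lss => /(_ (fun _ _ _ h h' => lexle_trans h' h)).
  by rewrite all_rcons => /andP[].
have nz t : t \in l :: rcons ls l' -> t <> [::] by case/lsP => -[].
have sE : s = (l ++ flatten ls) ++ l'.
  by rewrite -lsE /= -cats1 flatten_cat /= cats0 catA.
have /sgt_lexlt sl' : sgt l' s.
  apply: sL sE.
    by case: (l) (nz l (mem_head _ _)).
  by apply: nz; rewrite inE mem_rcons mem_head orbT.
have : lexlt l s.
  rewrite sE -catA; apply: lexlt_catr.
  have l'0 : l' <> [::] by apply: nz; rewrite inE mem_rcons mem_head orbT.
  by case: (flatten ls) => //; case: (l') l'0.
move=> ls_; have := lexlt_trans ls_ sl'.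
by move: l'l; rewrite lexleNlt => /negbTE ->.
Qed.

End Factor.
End Words.

(** * Left triangularity of crossings of words *)

Lemma mulrB_split (R : pzRingType) (a a' b b' : R) :
  a * b - a' * b' = (a - a') * b + a' * (b - b').
Proof. by rewrite mulrBl mulrBr addrA subrK. Qed.

Lemma addr_scale_sub (R : pzRingType) (M : lmodType R) (z : R) (x y x' y' : M) :
  x - z *: y + (x' - z *: y') = x + x' - z *: (y + y').
Proof. by rewrite addrACA -opprD -scalerDr. Qed.

Section Triangularity.
Context {k : fieldType} {disp : Order.disp_t} {X : finOrderType disp}.
Variable c : {linear {malg k[(X * X)%type]} -> {malg k[(X * X)%type]}}.
Variable g : X -> X -> k.
Hypothesis c_tri : left_triangular c g.
Notation W := {fmonom X}.
Notation TV := {malg k[W]}.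
Notation TVTV := {malg k[(W * W)%type]}.
Implicit Types (x y z : X) (s t : seq X) (u w : W) (a b e : TV) (Q : TVTV).

Lemma tri_letters x y :
  spanned (fun p : X * X => (y < p.1)%O) (c (bas (x, y)) - g x y *: bas (y, x)).
Proof.
have [vv /(_ x y)] := c_tri; rewrite !basE => ->; rewrite addrAC subrr add0r.
apply: spanned_sum => z _ yz; rewrite tensE basE.
apply: (@sub_spanned _ _ (fun p : X * X => (y < p.1)%O /\ True)).
  by move=> p [].
apply: (@spanned_tsr _ _ _ (fun z : X => (y < z)%O) (fun=> True)) => //.
exact: spannedU.
Qed.

(** Downward induction on [y]: tensors with left letter above [y] are images of tensors with right
    letter above [y]. If [g x y] were zero, c(x (x) y) would be such an image, and injectivity would
    place x (x) y among tensors with right letter above [y]. Being nonzero, [g x y] can be inverted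
    to reach y (x) x too. *)
Lemma gamma_letter_neq0 : injective c -> forall x y, g x y != 0.
Proof.
move=> c_inj.
have pre (P : X * X -> Prop) (K : X * X -> Prop) r : spanned P r ->
    (forall p, P p -> exists2 a, spanned K a & c a = bas p) ->
    exists2 a, spanned K a & c a = r.
  move=> Pr PK; rewrite [r]malg_sum_bas big_seq.
  apply: (big_ind (fun r => exists2 a, spanned K a & c a = r)).
  - by exists 0; [apply: spanned0 | rewrite linear0].
  - move=> _ _ [a Ka <-] [b Kb <-]; exists (a + b); last by rewrite linearD.
    exact: spannedD.
  - move=> p /Pr /PK [a Ka ca]; exists (r@_p *: a); last by rewrite linearZ ca.
    exact: spannedZ.
(* The measure is the number of letters above [y], so the induction starts at the greatest
   letter. *)
suff S n y : (#|[pred z | (y < z)%O]| < n)%N -> forall x, g x y != 0 /\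
    exists2 a, spanned (fun p : X * X => (y <= p.2)%O) a & c a = bas (y, x).
  by move=> x y; have [] := S _ y (ltnSn _) x.
elim: n y => // n IH y yn x.
have {}IH r : spanned (fun p : X * X => (y < p.1)%O) r ->
    exists2 a, spanned (fun p : X * X => (y < p.2)%O) a & c a = r.
  move=> /pre; apply=> -[z x'] /= yz.
  have zn : (#|[pred t | (z < t)%O]| < n)%N.
    apply: leq_trans (yn : (_ <= n)%N); apply: proper_card; apply/properP.
    split; first by apply/subsetP => t; rewrite !inE; apply: lt_trans.
    by exists z; rewrite !inE ?ltxx.
  have [_ [a aP ca]] := IH z zn x'; exists a => //.
  by apply: sub_spanned aP => p; apply: lt_le_trans.
have [a aP ca] := IH _ (@tri_letters x y).
have gn0 : g x y != 0.
  apply/eqP => g0; move: ca; rewrite g0 scale0r subr0 => /c_inj aE.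
  by have := aP (x, y); rewrite aE msupp_bas in_fset1 eqxx /= ltxx => /(_ isT).
split=> //; exists ((g x y)^-1 *: (bas (x, y) - a)).
  apply: spannedZ; apply: spannedB; first exact: spannedU.
  by apply: sub_spanned aP => p; apply: ltW.
by rewrite linearZ linearB /= ca opprB addrC subrK scalerA mulVf ?scale1r.
Qed.

Lemma FMonom_cons x s : mmul (fmu x) (FMonom s) = FMonom (x :: s).
Proof. by apply: word_eqP; rewrite wordM wordU. Qed.

Lemma FMonom_cat s t : mmul (FMonom s) (FMonom t) = FMonom (s ++ t).
Proof. by apply: word_eqP; rewrite wordM. Qed.

Lemma FMonom_nil : FMonom [::] = mone :> W.
Proof. by apply: word_eqP; rewrite word1. Qed.

Lemma FMonom1 x : FMonom [:: x] = fmu x.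
Proof. by apply: word_eqP; rewrite wordU. Qed.

Lemma braid1_tri x s :
  spanned (fun p : W * X => sgt p.1 s)
    (braid1 c x s - (\prod_(y <- s) g x y) *: bas (FMonom s, x)).
Proof.
elim: s x => [|y s IH] x.
  rewrite braid1_nil big_nil scale1r FMonom_nil subrr; exact: spanned0.
rewrite braid1_cons big_cons -(subrK (g x y *: bas (y, x)) (c _)) lextD.
rewrite lextZ lextU /= -addrA; apply: spannedD.
  apply: (spanned_lext (@tri_letters x y)) => p yp.
  apply: (spanned_lext (@spannedT _ _ _)) => q _; apply: spannedU.
  by rewrite wordM wordU /= yp.
rewrite -scalerA -scalerBr; apply: spannedZ.
rewrite -(subrK ((\prod_(y <- s) g x y) *: bas (FMonom s, x)) (braid1 c x s)).
rewrite lextD lextZ lextU /= FMonom_cons addrK.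
apply: (spanned_lext (IH x)) => q qs; apply: spannedU.
by rewrite wordM wordU /= eqxx qs orbT.
Qed.

Lemma gamma_word1l w : gamma_word g mone w = 1.
Proof. by rewrite /gamma_word word1 big_nil. Qed.

Lemma gamma_wordU x w : gamma_word g (fmu x) w = \prod_(y <- (w : seq X)) g x y.
Proof. by rewrite /gamma_word wordU big_seq1. Qed.

Lemma gamma_wordMl u u' w :
  gamma_word g (mmul u u') w = gamma_word g u w * gamma_word g u' w.
Proof. by rewrite /gamma_word wordM big_cat. Qed.

Lemma gamma_wordMr u w w' :
  gamma_word g u (mmul w w') = gamma_word g u w * gamma_word g u w'.
Proof.
by rewrite /gamma_word -big_split; apply: eq_bigr => x _; rewrite wordM big_cat.
Qed.

Lemma gamma_word_perm u u' w w' : perm_eq u u' -> perm_eq w w' ->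
  gamma_word g u w = gamma_word g u' w'.
Proof.
move=> uu' ww'; rewrite /gamma_word (perm_big _ uu').
by apply: eq_bigr => x _; apply: perm_big.
Qed.

Lemma gamma_word_neq0 : injective c -> forall u w, gamma_word g u w != 0.
Proof.
move=> /gamma_letter_neq0 g0 u w.
rewrite prodf_seq_neq0; apply/allP => x _ /=.
by rewrite prodf_seq_neq0; apply/allP => y _ /=; apply: g0.
Qed.

Definition sge s t := s = t \/ sgt s t.

(** Each crossing gives its diagonal term or raises the left factor at a first difference, and the
    remaining crossings never undo such a rise. *)
Lemma cross_tri u w :
  spanned (fun p : W * W => sgt p.1 w)
    (cross c u w - gamma_word g u w *: bas (w, u)).
Proof.
elim/(@word_ind X): u w => [|u x IH] w.
  rewrite cross1l gamma_word1l scale1r subrr; exact: spanned0.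
(* This weak form handles the terms in which crossing [x] has already raised the word. *)
have IH' w' : spanned (fun p : W * W => sge p.1 w') (cross c u w').
  rewrite -(subrK (gamma_word g u w' *: bas (w', u)) (cross c u w')).
  apply: spannedD; first by apply: sub_spanned (IH w') => p; right.
  by apply: spannedZ; apply: spannedU; left.
rewrite cross_rcons.
rewrite -(subrK ((\prod_(y <- (w : seq X)) g x y) *: bas (w, x)) (braid1 c x w)).
rewrite lextD lextZ lextU /= -addrA; apply: spannedD.
  have := @braid1_tri x w; rewrite fmK => br.
  apply: (spanned_lext br) => p pw; apply: (spanned_lext (IH' p.1)) => q qp.
  by apply: spannedU => /=; case: qp => [->//|qp]; apply: sgt_trans pw.
rewrite gamma_wordMl mulrC gamma_wordU -scalerA -scalerBr.
apply: spannedZ.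
rewrite -(subrK (gamma_word g u w *: bas (w, u)) (cross c u w)).
rewrite lextD lextZ lextU /= addrK.
by apply: (spanned_lext (IH w)) => q qs; apply: spannedU.
Qed.

Lemma cross_ge u w : spanned (fun p : W * W => sge p.1 w) (cross c u w).
Proof.
rewrite -(subrK (gamma_word g u w *: bas (w, u)) (cross c u w)).
apply: spannedD; first by apply: sub_spanned (@cross_tri u w) => p; right.
by apply: spannedZ; apply: spannedU; left.
Qed.

(** * Congruences modulo tensors with a large left factor *)

Definition spanned1 (P : seq X -> Prop) Q := spanned (fun p : W * W => P p.1) Q.

Definition cong (P : seq X -> Prop) Q Q' := spanned1 P (Q - Q').

Lemma cong_refl P Q : cong P Q Q.
Proof. by rewrite /cong subrr; apply: spanned0. Qed.

Lemma cong_sym P Q Q' : cong P Q Q' -> cong P Q' Q.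
Proof. by move=> h; rewrite /cong -opprB; apply: spannedN. Qed.

Lemma cong_trans P Q Q' Q'' : cong P Q Q' -> cong P Q' Q'' -> cong P Q Q''.
Proof.
by move=> h h'; rewrite /cong -(subrK Q' Q) -addrA; apply: spannedD.
Qed.

Lemma congD P Q1 Q2 Q1' Q2' :
  cong P Q1 Q1' -> cong P Q2 Q2' -> cong P (Q1 + Q2) (Q1' + Q2').
Proof.
by move=> h h'; rewrite /cong opprD addrACA; apply: spannedD.
Qed.

Lemma congZ P (z : k) Q Q' : cong P Q Q' -> cong P (z *: Q) (z *: Q').
Proof. by rewrite /cong -scalerBr; apply: spannedZ. Qed.

Lemma congB P Q1 Q2 Q1' Q2' :
  cong P Q1 Q1' -> cong P Q2 Q2' -> cong P (Q1 - Q2) (Q1' - Q2').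
Proof.
by move=> h1 h2; apply: congD => //; rewrite -!scaleN1r; apply: congZ.
Qed.

Lemma cong0 P Q : spanned1 P Q -> cong P Q 0.
Proof. by rewrite /cong subr0. Qed.

Lemma cong_sum P (J : Type) (r : seq J) (F G : J -> TVTV) :
  (forall j, cong P (F j) (G j)) ->
  cong P (\sum_(j <- r) F j) (\sum_(j <- r) G j).
Proof.
move=> FG; elim: r => [|j r IH]; first by rewrite !big_nil; apply: cong_refl.
by rewrite !big_cons; apply: congD.
Qed.

Lemma sub_cong (P P' : seq X -> Prop) Q Q' :
  (forall s, P s -> P' s) -> cong P Q Q' -> cong P' Q Q'.
Proof. by move=> PP'; apply: sub_spanned => p; apply: PP'. Qed.

Lemma spanned1_tsr (P : seq X -> Prop) a b :
  spanned (fun u : W => P u) a -> spanned1 P (tsr a b).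
Proof.
move=> Pa; apply: (@sub_spanned _ _ (fun p : W * W => P p.1 /\ True)).
  by move=> p [].
exact: (@spanned_tsr _ _ _ (fun u : W => P u) (fun=> True)).
Qed.

(* [upper P] makes the span of the u (x) w with [P u] stable under right
   multiplication, and under left multiplication by 1 (x) T(V). *)
Record upper (P : seq X -> Prop) : Prop := Upper {
  upper_cat : forall s t, P s -> P (s ++ t);
  upper_sgt : forall s t, sgt t s -> P s -> P t }.

Lemma upper_sgtl t : upper (fun s => sgt s t).
Proof. by split=> [s s'|s s' h h']; [apply: sgt_catr | apply: sgt_trans h']. Qed.

Lemma upper_sgt_inf t : upper (sgt_inf t).
Proof. by split=> [s s'|s s']; [apply: sgt_inf_catr | apply: sgt_inf_trans]. Qed.

Lemma spanned1_tmulr P Q Q' : upper P -> spanned1 P Q -> spanned1 P (tmul c Q Q').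
Proof.
move=> uP PQ; rewrite tmulE; apply: (spanned_lext PQ) => p Pp.
apply: (spanned_lext (@spannedT _ _ _)) => q _.
apply: (spanned_lext (@spannedT _ _ _)) => r _; apply: spannedU.
by rewrite wordM; apply: upper_cat.
Qed.

(** The words of [a] cross the left factors of [Q], and by [cross_ge] a crossing can only raise
    these. *)
Lemma spanned1_tmul_tsr1 P a Q :
  upper P -> spanned1 P Q -> spanned1 P (tmul c (tsr 1 a) Q).
Proof.
move=> uP PQ; rewrite tmulE malg1U lext_tsr lextU.
apply: (spanned_lext (@spannedT _ _ _)) => u _.
apply: (spanned_lext PQ) => q Pq.
apply: (spanned_lext (@cross_ge u q.1)) => r /= rq; apply: spannedU.
by rewrite mul1m; case: rq => [->//|rq]; apply: upper_sgt Pq.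
Qed.

Lemma spanned1_tmul_tsrl (P P' : seq X -> Prop) (R : W -> Prop) a Q :
  spanned R a -> spanned1 P Q -> (forall u w : W, R u -> P w -> P' (u ++ w)) ->
  spanned1 P' (tmul c (tsr a 1) Q).
Proof.
move=> Ra PQ RP; rewrite tmul_tsrl; apply: (spanned_lext Ra) => u Ru.
by apply: (spanned_lext PQ) => q Pq; apply: spannedU; rewrite wordM; apply: RP.
Qed.

Lemma cong_tmulr P Q1 Q2 Q :
  upper P -> cong P Q1 Q2 -> cong P (tmul c Q1 Q) (tmul c Q2 Q).
Proof. by move=> uP; rewrite /cong -tmulBl; apply: spanned1_tmulr. Qed.

Lemma cong_tmul_tsr1 P a Q1 Q2 :
  upper P -> cong P Q1 Q2 -> cong P (tmul c (tsr 1 a) Q1) (tmul c (tsr 1 a) Q2).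
Proof. by move=> uP; rewrite /cong -linearB; apply: spanned1_tmul_tsr1. Qed.

Lemma cong_tmul_tsrl (P P' : seq X -> Prop) (R : W -> Prop) a Q1 Q2 :
  spanned R a -> cong P Q1 Q2 -> (forall u w : W, R u -> P w -> P' (u ++ w)) ->
  cong P' (tmul c (tsr a 1) Q1) (tmul c (tsr a 1) Q2).
Proof.
by move=> Ra PQ RP; rewrite /cong -linearB; apply: spanned1_tmul_tsrl PQ RP.
Qed.

Lemma tmul_rl_cross a b :
  tmul c (tsr 1 a) (tsr b 1) = lext (fun u => lext (fun w => cross c u w) b) a.
Proof.
rewrite tmulE malg1U lext_tsr lextU; apply: eq_lext => u.
rewrite lext_tsr; apply: eq_lext => w; rewrite lextU -[RHS]lext_id.
by apply: eq_lext => -[p q] /=; rewrite mul1m mulm1.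
Qed.

(** [gamma_word] depends only on the letters with their multiplicities, so a single scalar serves
    for all words of [a] and [b]. *)
Lemma cong_swap s t a b :
  spanned (fun u : W => perm_eq u s) a ->
  spanned (fun u : W => perm_eq u t /\ sge u t) b ->
  cong (fun r => sgt r t) (tmul c (tsr 1 a) (tsr b 1))
    (gamma_word g (FMonom s) (FMonom t) *: tsr b a).
Proof.
move=> Sa Sb; rewrite /cong tmul_rl_cross tsrC -lext_funZ.
apply: (lextB_spanned Sa) => u us; rewrite -lext_funZ.
apply: (lextB_spanned Sb) => w [wt w_ge].
have <- : gamma_word g u w = gamma_word g (FMonom s) (FMonom t).
  exact: gamma_word_perm.
apply: sub_spanned (@cross_tri u w) => p pw.
by case: w_ge => [<-//|]; apply: sgt_trans.
Qed.

(** Monic with leading word [s]. Requiring the other words to be rearrangements of [s] fixes their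
    length and their gamma scalars; using [sgt] makes leading words multiplicative. *)
Definition lead s a :=
  spanned (fun u : W => perm_eq u s /\ sgt u s) (a - bas (FMonom s)).

Lemma lead_ge s a : lead s a -> spanned (fun u : W => perm_eq u s /\ sge u s) a.
Proof.
move=> sa; rewrite -(subrK (bas (FMonom s)) a); apply: spannedD.
  by apply: sub_spanned sa => u [? ?]; split=> //; right.
by apply: spannedU; split=> //; left.
Qed.

Lemma lead_perm s a : lead s a -> spanned (fun u : W => perm_eq u s) a.
Proof. by move/lead_ge; apply: sub_spanned => u []. Qed.

Lemma lead_sge s a : lead s a -> spanned (fun u : W => sge u s) a.
Proof. by move/lead_ge; apply: sub_spanned => u []. Qed.

Lemma lead1 : lead [::] 1.
Proof. by rewrite /lead malg1U FMonom_nil subrr; apply: spanned0. Qed.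

Lemma lead_mul s t a b : lead s a -> lead t b -> lead (s ++ t) (a * b).
Proof.
move=> sa tb; rewrite /lead -FMonom_cat -malgMUU.
rewrite mulrB_split.
apply: spannedD.
  apply: (spanned_mul sa (lead_ge tb)) => u w [us uss] [wt _]; rewrite wordM.
  by split; [apply: perm_cat | apply: sgt_cat].
apply: (@spanned_mul _ _ (fun u : W => u = s :> seq X) _ _ _ _ _ tb).
  exact: spannedU.
move=> u w us [wt wtt]; rewrite wordM us.
by split; [rewrite perm_cat2l | rewrite sgt_cat2l].
Qed.

(** The scalar of the braided commutator is the one for which the mixed terms [B] cancel. *)
Lemma cong_delta_commutator P a b (B : TVTV) (q : k) : q != 0 ->
  cong P (delta c a) (tsr a 1 + B + tsr 1 a) ->
  cong P (delta c b) (q *: B + tsr 1 b) -> cong P (tsr b 1) 0 ->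
  cong P (delta c (a - q^-1 *: b)) (tsr (a - q^-1 *: b) 1 + tsr 1 (a - q^-1 *: b)).
Proof.
move=> q0 Ea Eb Zb; rewrite linearB linearZ /=.
apply: cong_trans (congB Ea (@congZ _ q^-1 _ _ Eb)) _.
rewrite tsrBZl tsrBZr addr_scale_sub.
have -> (A C F : TVTV) : A + B + C - q^-1 *: (q *: B + F)
    = A + C - q^-1 *: (0 + F).
  rewrite add0r scalerDr scalerA mulVf // scale1r opprD addrA; congr (_ - _).
  by rewrite addrAC addrK.
apply: congB (@cong_refl _ _) _; apply: congZ.
by apply: congD (@cong_refl _ _); apply: cong_sym.
Qed.

(** What a super-letter of [s] must satisfy: leading word [s], and primitivity up to left factors
    beyond [s]. *)
Record good s e : Prop := Good {
  good_lead : lead s e;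
  good_delta : cong (fun r => sgt r s) (delta c e) (tsr e 1 + tsr 1 e) }.

Lemma good_letter x : good [:: x] (bas (fmu x)).
Proof.
split; first by rewrite /lead FMonom1 subrr; apply: spanned0.
by rewrite delta_letter addrC; apply: cong_refl.
Qed.

(** The words of [e2 * e1] start at least as high as [t], hence exceed s t, so the commutator keeps
    the leading word of [e1 * e2]. Its second term serves to cancel the mixed tensor e1 (x) e2 in
    the coproduct. *)
Lemma good_merge s t e1 e2 : gamma_word g (FMonom t) (FMonom s) != 0 ->
  sgt t (s ++ t) -> good s e1 -> good t e2 ->
  good (s ++ t) (e1 * e2 - (gamma_word g (FMonom t) (FMonom s))^-1 *: (e2 * e1)).
Proof.
set q := gamma_word _ _ _ => q0 tst [l1 d1] [l2 d2]; split.
  rewrite /lead addrAC; apply: spannedB; first exact: lead_mul.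
  apply: spannedZ; apply: sub_spanned (lead_ge (lead_mul l2 l1)) => u [uts ge].
  split; first by rewrite (perm_trans uts) // perm_catC.
  have := sgt_catr s tst.
  by case: ge => [->//|]; apply: sgt_trans.
set P := fun r => sgt r (s ++ t).
have uP : upper P := upper_sgtl _.
have P2 r : sge r t -> P r.
  by case=> [->//|]; rewrite /P => rt; apply: sgt_trans tst.
have D1 : cong P (delta c e1) (tsr e1 1 + tsr 1 e1).
  by apply: sub_cong d1 => u; apply: sgt_catrr.
have D2 : cong P (delta c e2) (tsr e2 1 + tsr 1 e2).
  by apply: sub_cong d2 => u ut; apply: P2; right.
have P2l : spanned (fun u : W => P u) e2.
  by apply: sub_spanned (lead_sge l2) => u; apply: P2.
have E12 : cong P (delta c (e1 * e2))
    (tsr (e1 * e2) 1 + tsr e1 e2 + tsr 1 (e1 * e2)).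
  rewrite deltaM; apply: cong_trans (cong_tmulr uP D1) _; rewrite tmulDl.
  apply: congD.
    have -> : tsr (e1 * e2) 1 + tsr e1 e2 =
        tmul c (tsr e1 1) (tsr e2 1 + tsr 1 e2).
      by rewrite linearD /= tmul_ll tmul_lr.
    (* The sharp form [d2] is used: prefixing a word at least [s] turns left factors beyond [t] into
       left factors beyond s t. *)
    apply: (cong_tmul_tsrl (lead_sge l1) d2) => u w [->|us] wt.
      by rewrite /P sgt_cat2l.
    exact: sgt_cat.
  apply: cong_trans (cong_tmul_tsr1 uP D2) _.
  rewrite linearD /= tmul_rr -[X in cong _ _ X]add0r; apply: congD (@cong_refl _ _).
  by apply: cong0; apply: spanned1_tmul_tsr1 => //; apply: spanned1_tsr.
(* Whatever starts with e2 (x) 1 is an error term; the swap of 1 (x) e2 with e1 (x) 1 yields the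
   factor [q]. *)
have E21 : cong P (delta c (e2 * e1)) (q *: tsr e1 e2 + tsr 1 (e2 * e1)).
  rewrite deltaM; apply: (@cong_trans _ _ (tmul c (tsr 1 e2) (delta c e1))).
    apply: cong_tmulr => //; apply: cong_trans D2 _.
    rewrite -[X in cong _ _ X]add0r; apply: congD (@cong_refl _ _).
    by apply: cong0; apply: spanned1_tsr.
  apply: cong_trans (cong_tmul_tsr1 uP D1) _.
  rewrite linearD /= tmul_rr; apply: congD (@cong_refl _ _).
  apply: sub_cong (cong_swap (lead_perm l2) (lead_ge l1)) => u.
  exact: sgt_catrr.
have Z21 : cong P (tsr (e2 * e1) 1) 0.
  apply: cong0; apply: spanned1_tsr.
  apply: (@spanned_mul _ _ (fun u : W => P u) (fun=> True)) => //.
  by move=> u w Pu _; rewrite wordM; apply: (upper_cat uP).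
exact: cong_delta_commutator E12 E21 Z21.
Qed.

End Triangularity.

(** * Gaussian binomials by the Pascal rule, free of division *)

Fixpoint qbin (R : pzRingType) (q : R) (n m : nat) : R :=
  match n, m with
  | _, 0 => 1
  | 0, _.+1 => 0
  | n'.+1, m'.+1 => qbin q n' m' + q ^+ m'.+1 * qbin q n' m'.+1
  end.

Lemma qbin0 (R : pzRingType) (q : R) n : qbin q n 0 = 1.
Proof. by case: n. Qed.

Lemma qbin_gt (R : pzRingType) (q : R) n m : (n < m)%N -> qbin q n m = 0.
Proof.
elim: n m => [|n IH] [|m] //= nm.
by rewrite !IH ?mulr0 ?addr0 // ltnW.
Qed.

Lemma qbinn (R : pzRingType) (q : R) n : qbin q n n = 1.
Proof. by elim: n => //= n ->; rewrite qbin_gt // mulr0 addr0. Qed.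

(** The induction step of every q-binomial expansion, stated for module-valued terms: it serves both
    the coproduct of a power and Gauss's formula. *)
Lemma qbin_sumS (R : comPzRingType) (M : lmodType R) (q : R) n (F : nat -> M) :
  \sum_(i < n.+2) qbin q n.+1 i *: F i =
  \sum_(i < n.+1) qbin q n i *: F i.+1 +
  \sum_(i < n.+1) (qbin q n i * q ^+ i) *: F i.
Proof.
rewrite big_ord_recl [X in _ = _ + X]big_ord_recl /= qbin0 expr0 mulr1.
rewrite [RHS]addrCA; congr (_ + _).
under eq_bigr do rewrite scalerDl.
rewrite big_split /=; congr (_ + _).
rewrite big_ord_recr /= qbin_gt // mulr0 scale0r addr0.
by apply: eq_bigr => i _; rewrite mulrC.
Qed.

(** * Super-letters and coproducts of their products *)

Section SuperLetters.
Context {k : fieldType} {disp : Order.disp_t} {X : finOrderType disp}.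
Variable c : {linear {malg k[(X * X)%type]} -> {malg k[(X * X)%type]}}.
Variable g : X -> X -> k.
Hypothesis c_tri : left_triangular c g.
Hypothesis c_inj : injective c.
Notation W := {fmonom X}.
Notation TV := {malg k[W]}.
Notation TVTV := {malg k[(W * W)%type]}.
Implicit Types (x y z : X) (s t : seq X) (u w : W) (a b e : TV) (Q : TVTV).
Implicit Types (ls : seq (seq X)).

Lemma lyn_good s : lyn s -> exists e, good c s e.
Proof.
apply: (@lyn_P _ _ (fun s => exists e, good c s e)) =>
  [x|{}s t sL tL [e1 g1] [e2 g2] st].
  by exists (bas (fmu x)); apply: good_letter.
eexists; apply: (good_merge c_tri _ _ g1 g2); last exact: sgt_merge.
exact: (gamma_word_neq0 c_tri c_inj).
Qed.

(** Any element with the properties [good] will do, so one is chosen without fixing a factorization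
    of [s]. *)
Definition super s : TV := epsilon (inhabits 0) (good c s).

Lemma superP s : lyn s -> good c s (super s).
Proof. by move=> /lyn_good; apply: epsilon_spec. Qed.

Definition superword ls : TV := \prod_(l <- ls) super l.

Lemma superword_cons l ls : superword (l :: ls) = super l * superword ls.
Proof. exact: big_cons. Qed.

Lemma superword_nseq v n : superword (nseq n v) = super v ^+ n.
Proof. by elim: n => [|n IH]; rewrite /= ?exprS -?IH;
  [apply: big_nil | apply: big_cons]. Qed.

Lemma superword_cat ls ls' : superword (ls ++ ls') = superword ls * superword ls'.
Proof. exact: big_cat. Qed.

Lemma lead_superword ls :
  (forall l, l \in ls -> lyn l) -> lead (flatten ls) (superword ls).
Proof.
elim: ls => [|l ls IH] lsL.
  by rewrite /superword big_nil; apply: lead1.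
rewrite superword_cons; apply: lead_mul.
  by apply/good_lead/superP/lsL; rewrite mem_head.
by apply: IH => t tls; apply: lsL; rewrite inE tls orbT.
Qed.

Lemma lead_superX v n : lyn v -> lead (word_pow v n) (super v ^+ n).
Proof.
move=> vL; rewrite -superword_nseq; apply: lead_superword => l.
by rewrite mem_nseq => /andP[_ /eqP->].
Qed.

Definition gseq s t := gamma_word g (FMonom s) (FMonom t).

Lemma gseq_cat s t t' : gseq s (t ++ t') = gseq s t * gseq s t'.
Proof. by rewrite /gseq -gamma_wordMr FMonom_cat. Qed.

Lemma gseq_nil s : gseq s [::] = 1.
Proof.
by rewrite /gseq /gamma_word; under eq_bigr do rewrite big_nil; rewrite big1.
Qed.

Lemma gseq_pow s t n : gseq s (word_pow t n) = gseq s t ^+ n.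
Proof.
elim: n => [|n IH]; first by rewrite gseq_nil.
by rewrite word_powS gseq_cat IH exprS.
Qed.

Lemma gseq_neq0 s t : gseq s t != 0.
Proof. exact: (gamma_word_neq0 c_tri c_inj). Qed.

Lemma cong_tmul_tsr1_superX v s a b n : lyn v ->
  spanned (fun u : W => perm_eq u s) a ->
  cong (sgt_inf v) (tmul c (tsr 1 a) (tsr (super v ^+ n) b))
    (gseq s v ^+ n *: tsr (super v ^+ n) (a * b)).
Proof.
move=> vL Sa; have := @lead_superX _ n vL; move: (super v ^+ n) => e le.
have -> : tsr e b = tmul c (tsr e 1) (tsr 1 b) by rewrite tmul_lr.
have -> : gseq s v ^+ n *: tsr e (a * b) =
    tmul c (gseq s v ^+ n *: tsr e a) (tsr 1 b) by rewrite tmulZl tmul_rr.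
rewrite tmulA; apply: cong_tmulr; first exact: upper_sgt_inf.
rewrite -gseq_pow; apply: sub_cong (cong_swap c_tri Sa (lead_ge le)) => r.
exact: sgt_inf_powm.
Qed.

Lemma upper_inf_superl v u s : sge u v -> sgt_inf v s -> sgt_inf v (u ++ s).
Proof.
by case=> [->|uv]; [apply: sgt_inf_catl | move=> _; apply/sgt_inf_catr/sgt_inf_pow].
Qed.

Lemma delta_superX v n : lyn v ->
  cong (sgt_inf v) (delta c (super v ^+ n))
    (\sum_(i < n.+1) qbin (gseq v v) n i *:
       tsr (super v ^+ i) (super v ^+ (n - i))).
Proof.
move=> vL; have [lv dv] := superP vL; have uv := upper_sgt_inf v.
elim: n => [|n IH].
  by rewrite big_ord1 /= scale1r !expr0 delta1; apply: cong_refl.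
rewrite exprS deltaM.
apply: (@cong_trans _ _ _ _ _
    (tmul c (tsr (super v) 1 + tsr 1 (super v)) (delta c (super v ^+ n)))).
  by apply: cong_tmulr => //; apply: sub_cong dv => r; apply: sgt_inf_pow.
rewrite (qbin_sumS _ _ (fun i => tsr (super v ^+ i) (super v ^+ (n.+1 - i)))).
rewrite tmulDl; apply: congD.
  apply: cong_trans (cong_tmul_tsrl (lead_sge lv) IH (@upper_inf_superl v)) _.
  rewrite linear_sum /=; apply: cong_sum => i.
  by rewrite linearZ /= tmul_ll exprS subSS; apply: cong_refl.
apply: cong_trans (cong_tmul_tsr1 c_tri uv IH) _.
rewrite linear_sum /=; apply: cong_sum => i.
rewrite linearZ /= -scalerA; apply: congZ.
rewrite subSn -1?ltnS // [super v ^+ (n - i).+1]exprS.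
by apply: cong_tmul_tsr1_superX; last exact: lead_perm.
Qed.

(** For a letter l beyond vvv... the term [l] (x) 1 is itself an error, so only 1 (x) [l] acts. *)
Lemma delta_superword_mul v ls b :
  (forall l, l \in ls -> lyn l /\ sgt_inf v l) ->
  cong (sgt_inf v) (delta c (superword ls * b))
    (tmul c (tsr 1 (superword ls)) (delta c b)).
Proof.
have uv := upper_sgt_inf v; elim: ls => [|l ls IH] lsP.
  by rewrite /superword big_nil mul1r tmul1l; apply: cong_refl.
rewrite superword_cons -mulrA deltaM.
have [lL vl] := lsP l (mem_head _ _); have [ll dl] := superP lL.
have {}IH : cong (sgt_inf v) (delta c (superword ls * b))
    (tmul c (tsr 1 (superword ls)) (delta c b)).
  by apply: IH => t tls; apply: lsP; rewrite inE tls orbT.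
apply: (@cong_trans _ _ _ _ _
    (tmul c (tsr 1 (super l)) (delta c (superword ls * b)))).
  apply: cong_tmulr => //.
  apply: (@cong_trans _ _ _ _ _ (tsr (super l) 1 + tsr 1 (super l))).
    by apply: sub_cong dl => r rl; apply: sgt_inf_trans vl.
  rewrite -[X in cong _ _ X]add0r; apply: congD (@cong_refl _ _ _ _ _).
  apply: cong0; apply: spanned1_tsr; apply: sub_spanned (lead_sge ll) => u.
  by case=> [->//|ul]; apply: sgt_inf_trans vl.
apply: cong_trans (cong_tmul_tsr1 c_tri uv IH) _.
by rewrite tmulA tmul_rr; apply: cong_refl.
Qed.

(* The coproduct of a nonincreasing product of super-letters, modulo tensors
   whose left factor exceeds vvv...; v is the smallest of the letters. *)
Lemma delta_superword v ls n : lyn v ->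
  (forall l, l \in ls -> lyn l /\ sgt_inf v l) ->
  cong (sgt_inf v) (delta c (superword ls * super v ^+ n))
    (\sum_(i < n.+1) (qbin (gseq v v) n i * gseq (flatten ls) v ^+ i) *:
       tsr (super v ^+ i) (superword ls * super v ^+ (n - i))).
Proof.
move=> vL lsP; have uv := upper_sgt_inf v.
apply: cong_trans (delta_superword_mul lsP) _.
apply: cong_trans (cong_tmul_tsr1 c_tri uv (@delta_superX _ n vL)) _.
rewrite linear_sum /=; apply: cong_sum => i; rewrite linearZ /= -scalerA.
apply: congZ; apply: cong_tmul_tsr1_superX => //.
by apply/lead_perm/lead_superword => l /lsP [].
Qed.

End SuperLetters.

Lemma list_min (T : eqType) (r : rel T) (l : seq T) :
  transitive r -> (forall x y, [|| x == y, r x y | r y x]) -> l <> [::] ->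
  exists2 x, x \in l & forall y, y \in l -> y = x \/ r x y.
Proof.
move=> tr tot; elim: l => // x [|x' l] IH _.
  by exists x => [|y]; rewrite inE => // /eqP->; left.
have [//|m ml mP] := IH; have := tot x m; case/or3P => [/eqP xm|xm|mx].
- exists m => [|y]; rewrite inE ?ml ?orbT //.
  by case/predU1P => [->|/mP //]; left.
- exists x => [|y]; rewrite inE ?eqxx //.
  case/predU1P => [->|/mP [->|my]]; [by left|by right|right].
  exact: tr my.
- exists m => [|y]; rewrite inE ?ml ?orbT //.
  by case/predU1P => [->|/mP //]; right.
Qed.

(** * The standard order on words *)

Section StandardOrder.
Context {disp : Order.disp_t} {X : finOrderType disp}.
Notation W := {fmonom X}.
Implicit Types u v w : W.

Lemma std_gtE u w : std_gt u w =
  (size u < size w)%N || ((size u == size w) && lexlt w u).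
Proof. by []. Qed.

Lemma sgt_std_gt u w : (size u <= size w)%N -> sgt u w -> std_gt u w.
Proof.
rewrite leq_eqVlt std_gtE; case/orP => [->|-> //] /sgt_lexlt ->.
by rewrite orbT.
Qed.

Lemma std_gt_trans : transitive (@std_gt _ X).
Proof.
move=> v u w; rewrite !std_gtE; case/orP => [uv|/andP[/eqP-> vu]].
  by case/orP => [vw|/andP[/eqP<- _]]; rewrite ?uv ?(ltn_trans uv vw).
case/orP => [->//|/andP[-> wv]]; by rewrite (lexlt_trans wv vu) orbT.
Qed.

Lemma std_gt_irr u : std_gt u u = false.
Proof. by rewrite std_gtE ltnn lexlt_irr andbF. Qed.

Lemma lexlt_total (s t : seq X) : [|| s == t, lexlt s t | lexlt t s].
Proof. by rewrite /lexlt; case: (ltgtP (s : seqlexi X) t) => // ->; rewrite eqxx. Qed.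

Lemma std_gt_total u w : [|| u == w, std_gt w u | std_gt u w].
Proof.
rewrite !std_gtE fmP; case: ltngtP => // [||uw] //=; rewrite ?orbT //.
exact: lexlt_total.
Qed.

Lemma std_gt_mul x y u w : std_gt u w -> std_gt (mmul (mmul x u) y) (mmul (mmul x w) y).
Proof.
rewrite !std_gtE !wordM !size_cat; case/orP => [uw|/andP[/eqP uw wu]].
  by rewrite ltn_add2r ltn_add2l uw.
rewrite uw ltnn eqxx /= -!catA; apply: sgt_lexlt.
by rewrite sgt_cat2l; apply: sgt_cat; apply: lexlt_sgt wu; rewrite uw.
Qed.

(** Nested induction on the length and on the number of lexicographically greater words of that
    length, finite because the alphabet is. *)
Lemma std_ind (P : W -> Prop) :
  (forall u, (forall w, std_gt w u -> P w) -> P u) -> forall u, P u.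
Proof.
move=> Pind u; have [n] := ubnP (size u); elim: n u => // n IHn u un.
pose m := #|[pred t : (size u).-tuple X | lexlt u t]|.
have [p] := ubnP m; rewrite {}/m; elim: p u un => // p IHp u un up.
apply: Pind => w; rewrite std_gtE; case/orP => [wu|/andP[/eqP wu uw]].
  by apply: IHn; apply: leq_trans wu _.
apply: IHp; first by rewrite wu.
rewrite wu; apply: leq_trans (up : (_ <= p)%N).
have sw : size w == size u by rewrite wu.
apply: proper_card; apply/properP; split.
  by apply/subsetP => t; rewrite !inE; apply: lexlt_trans.
by exists (Tuple sw); rewrite !inE //= lexlt_irr.
Qed.

End StandardOrder.

(** * Normal forms modulo an ideal *)

Section NormalForms.
Context {k : fieldType} {disp : Order.disp_t} {X : finOrderType disp}.
Notation W := {fmonom X}.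
Notation TV := {malg k[W]}.
Variable I : TV -> Prop.
Hypothesis Iideal : two_sided_ideal I.
Implicit Types (u v w : W) (a b r : TV).

Lemma idealZ z a : I a -> I (z *: a).
Proof. by move=> Ia; rewrite -[a]mul1r scalerAl; apply: tsiMl. Qed.

Lemma idealN a : I a -> I (- a).
Proof. by rewrite -scaleN1r; apply: idealZ. Qed.

Lemma idealB a b : I a -> I b -> I (a - b).
Proof.
by move=> Ia Ib; apply: tsiD => //; apply: idealN.
Qed.

Definition irred u := ~ reducible I u.

Lemma reducibleP u : reducible I u <->
  exists2 a, spanned (fun w => std_gt w u) a & I (bas u - a).
Proof.
split=> [[a [b [au Ib]]]|[a au Ib]].
  by rewrite basE => ub; exists a => //; rewrite ub addrAC subrr add0r.
by exists a, (bas u - a); split=> //; rewrite basE addrC subrK.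
Qed.

Lemma reducible_mul x y u : reducible I u -> reducible I (mmul (mmul x u) y).
Proof.
case/reducibleP => a au Ib; apply/reducibleP.
exists (lext (fun w => bas (mmul (mmul x w) y)) a).
  by apply: (spanned_lext au) => w wu; apply: spannedU; apply: std_gt_mul.
have -> : bas (mmul (mmul x u) y) - lext (fun w => bas (mmul (mmul x w) y)) a =
    bas x * (bas u - a) * bas y; last by apply: tsiMr => //; apply: tsiMl.
rewrite malgM_lext lext_mul lextU.
have -> : bas (mmul (mmul x u) y) =
  lext (fun w => bas (mmul (mmul x w) y)) (bas u) :> TV by rewrite lextU.
by rewrite -linearB; apply: eq_lext => w; rewrite lextU.
Qed.

Lemma irred_cat (s t r : seq X) :
  irred (FMonom (s ++ t ++ r)) -> irred (FMonom t).
Proof.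
move=> ir /(reducible_mul (FMonom s) (FMonom r)).
by rewrite !FMonom_cat -catA.
Qed.

Section Family.
Variable E : W -> TV.
Hypothesis E_lead : forall u, spanned (fun w => std_gt w u) (E u - bas u).

(** The family [E] is later taken to be the words themselves, for normal forms, and products of
    super-letters, for the relation at v^h. *)
Let reduced a (P : W -> Prop) :=
  exists2 r, spanned (fun w => irred w /\ P w) r & I (a - lext E r).

Lemma reduced_spanned a (P Q : W -> Prop) :
  spanned Q a -> (forall u, Q u -> reduced (bas u) P) -> reduced a P.
Proof.
move=> Qa QP; rewrite [a]malg_sum_bas big_seq.
apply: (big_ind (fun a => reduced a P)).
- by exists 0; [apply: spanned0 | rewrite linear0 subr0; apply: tsi0].
- move=> _b _b' [r rP Ir] [r' rP' Ir']; exists (r + r'); first exact: spannedD.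
  by rewrite linearD opprD addrACA; apply: tsiD.
- move=> u /Qa /QP [r rP Ir]; exists (a@_u *: r); first exact: spannedZ.
  by rewrite linearZ -scalerBr; apply: idealZ.
Qed.

(** A reducible word is replaced modulo [I] by greater words, an irreducible word w by [E w] minus
    greater words; both kinds of replacement terminate by [std_ind]. *)
Lemma reduced_gt a u : spanned (fun w => std_gt w u) a ->
  reduced a (fun w => std_gt w u).
Proof.
elim/(@std_ind _ X): u a => u IH a au; apply: reduced_spanned au _ => w wu.
have [/reducibleP [b bw Ib]|wi] := classic (reducible I w).
  have [r rP Ir] := IH w wu b bw; exists r.
    by apply: sub_spanned rP => t [it tw]; split=> //; apply: std_gt_trans wu.
  by rewrite -(subrK b (bas w)) -addrA; apply: tsiD.
(* Here [r] represents the excess of [E w] over w, so w itself is represented by w - r. *)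
have [r rP Ir] := IH w wu _ (@E_lead w); exists (bas w - r).
  apply: spannedB; first exact: spannedU.
  by apply: sub_spanned rP => t [it tw]; split=> //; apply: std_gt_trans wu.
have -> : bas w - lext E (bas w - r) = - (E w - bas w - lext E r).
  by rewrite linearB /= lextU !opprB addrCA.
exact: idealN.
Qed.

End Family.

(** The smallest word in the support of a nonzero element of [I] could be expressed through the
    greater ones, hence would be reducible. *)
Lemma irred_free r : spanned irred r -> I r -> r = 0.
Proof.
move=> rP Ir; apply/eqP; rewrite -msupp_eq0; apply/negPn/negP => r0.
have [|||u ur umin] := @list_min _ (fun u w => std_gt w u) (msupp r : seq W).
- by move=> v u w uv vw; apply: std_gt_trans uv.
- exact: std_gt_total.
- by move=> rE; case/fset0Pn: r0 => u; rewrite -[u \in _]/(u \in (msupp r : seq W)) rE.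
have ru : r@_u != 0 by rewrite mcoeff_neq0.
apply: (rP u ur); apply/reducibleP; exists (bas u - (r@_u)^-1 *: r).
  move=> w wP.
  have wu : w <> u.
    move=> wu; move: wP; rewrite wu -mcoeff_neq0 mcoeffB mcoeffZ mcoeff_bas eqxx.
    by rewrite mulVf // subrr eqxx.
  move: wP => /(fsubsetP (msuppB_le _ _)); rewrite in_fsetU msupp_bas in_fset1.
  case/orP => [/eqP//|/(fsubsetP (msuppZ_le _ _)) wr].
  by case: (umin w wr).
by rewrite subKr; apply: idealZ.
Qed.

(** The functional is the coefficient at [u0] of the normal form. It vanishes on greater words
    because the normal form of a word contains no smaller word. *)
Lemma irred_functional u0 : irred u0 -> exists f : W -> k,
  [/\ forall a, I a -> lext (f : W -> k^o) a = 0, f u0 = 1 &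
      forall w, std_gt w u0 -> f w = 0].
Proof.
move=> u0i.
have E_lead u : spanned (fun w => std_gt w u) (bas u - bas u : TV).
  by rewrite subrr; apply: spanned0.
have nf u : exists r, [/\ spanned irred r, I (bas u - r) &
    spanned (fun w => w = u \/ std_gt w u) r].
  have [/reducibleP [a au Ia]|ui] := classic (reducible I u).
    have [r rP] := reduced_gt E_lead au; rewrite lext_id => Ir.
    exists r; split; [by apply: sub_spanned rP => w [] | |].
      by rewrite -(subrK a (bas u)) -addrA; apply: tsiD.
    by apply: sub_spanned rP => w [_ wu]; right.
  exists (bas u); split; [exact: spannedU | | by apply: spannedU; left].
  by rewrite subrr; apply: tsi0.
pose N u := epsilon (inhabits (0 : TV)) (fun r => [/\ spanned irred r, I (bas u - r) &
    spanned (fun w => w = u \/ std_gt w u) r]).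
have NP u : [/\ spanned irred (N u), I (bas u - N u) &
    spanned (fun w => w = u \/ std_gt w u) (N u)] := epsilon_spec _ _ (nf u).
have N_irred a : spanned irred (lext N a).
  by apply: (spanned_lext (@spannedT _ _ a)) => u _; have [] := NP u.
have N_eq a : I (a - lext N a).
  rewrite -{1}(lext_id a) !lext_sum -sumrB.
  apply: (big_ind I) => [||u _]; [exact: tsi0 | exact: tsiD |].
  by rewrite -scalerBr; apply: idealZ; have [] := NP u.
exists (fun u => (N u)@_u0); split.
- move=> a Ia; have /(irred_free (N_irred a)) Na : I (lext N a).
    by rewrite -[lext N a](subKr a); apply: idealB; [exact: Ia | exact: N_eq].
  transitivity ((lext N a)@_u0); last by rewrite Na mcoeff0.
  rewrite !lext_sum raddf_sum; apply: eq_bigr => u _ /=.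
  by rewrite mcoeffZ.
- have := N_eq (bas u0); rewrite lextU => Iu.
  have /(irred_free) : spanned irred (bas u0 - N u0).
    by apply: spannedB; [apply: spannedU | have [] := NP u0].
  by move=> /(_ Iu) /eqP; rewrite subr_eq0 => /eqP <-; rewrite mcoeff_bas eqxx.
move=> w wu; apply: mcoeff_outdom; apply/negP.
have [_ _ h] := NP w => /h [uw|uw].
  by move: wu; rewrite uw std_gt_irr.
by move: (std_gt_trans uw wu); rewrite std_gt_irr.
Qed.

End NormalForms.

(** * The coproduct preserves total length *)

Section Grading.
Context {k : fieldType} {X : choiceType}.
Variable c : {malg k[(X * X)%type]} -> {malg k[(X * X)%type]}.
Notation W := {fmonom X}.
Notation TV := {malg k[W]}.
Notation TVTV := {malg k[(W * W)%type]}.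
Implicit Types (x : X) (s : seq X) (u w : W) (a b : TV) (P Q R : TVTV).

Lemma braid1_size x s :
  spanned (fun p : W * X => size p.1 = size s) (braid1 c x s).
Proof.
elim: s x => [|y s IH] x; first by rewrite braid1_nil; apply: spannedU; rewrite word1.
rewrite braid1_cons; apply: (spanned_lext (@spannedT _ _ _)) => p _.
apply: (spanned_lext (IH p.2)) => q qs; apply: spannedU.
by rewrite wordM wordU /= qs.
Qed.

Lemma cross_size u w :
  spanned (fun p : W * W => size p.1 = size w /\ size p.2 = size u) (cross c u w).
Proof.
elim/(@word_ind X): u w => [|u x IH] w; first by rewrite cross1l; apply: spannedU.
rewrite cross_rcons; apply: (spanned_lext (@braid1_size x w)) => p pw.
apply: (spanned_lext (IH p.1)) => q [q1 q2]; apply: spannedU => /=.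
by rewrite !wordM !wordU !size_cat q1 q2.
Qed.

Definition graded2 n (p : W * W) := (size p.1 + size p.2 = n)%N.

Lemma tmul_graded m n P Q : spanned (graded2 m) P -> spanned (graded2 n) Q ->
  spanned (graded2 (m + n)) (tmul c P Q).
Proof.
move=> gP gQ; rewrite tmulE; apply: (spanned_lext gP) => p pm.
apply: (spanned_lext gQ) => q qn.
apply: (spanned_lext (@cross_size p.2 q.1)) => r [r1 r2]; apply: spannedU.
by move: pm qn; rewrite /graded2 /= => <- <-; rewrite !wordM !size_cat r1 r2 addnACA.
Qed.

Lemma tsr_graded m n a b : spanned (fun u => size u = m) a ->
  spanned (fun u => size u = n) b -> spanned (graded2 (m + n)) (tsr a b).
Proof.
move=> am bn; apply: sub_spanned (spanned_tsr am bn) => p [p1 p2].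
by rewrite /graded2 p1 p2.
Qed.

Lemma spanned_size1 : spanned (fun u => size u = 0) (1 : TV).
Proof. by rewrite malg1U; apply: spannedU; rewrite word1. Qed.

Lemma delta_graded n a : spanned (fun u => size u = n) a ->
  spanned (graded2 n) (delta c a).
Proof.
move=> an; rewrite deltaE; apply: (spanned_lext an) => u <-.
have x1 x : spanned (fun u => size u = 1) (bas (fmu x) : TV).
  by apply: spannedU; rewrite wordU.
elim: (u : seq X) => [|x s IH] /=; first exact: (tsr_graded spanned_size1 spanned_size1).
rewrite -add1n; apply: (tmul_graded _ IH); apply: spannedD.
  exact: (tsr_graded spanned_size1 (x1 x)).
exact: (tsr_graded (x1 x) spanned_size1).
Qed.

End Grading.

(** * Functionals on the tensor square *)

Lemma lext_tsrZ (k : fieldType) (A B : choiceType) (M : lmodType k)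
    (f : A -> k) (F : B -> M) (a : {malg k[A]}) (b : {malg k[B]}) :
  lext (fun p : A * B => f p.1 *: F p.2) (tsr a b) =
  lext (f : A -> k^o) a *: lext F b.
Proof.
rewrite lext_tsr !(lext_sum _ a) scaler_suml; apply: eq_bigr => i _ /=.
by rewrite lext_funZ scalerA.
Qed.

Section Functional.
Context {k : fieldType} {X : choiceType}.
Notation W := {fmonom X}.
Notation TV := {malg k[W]}.
Notation TVTV := {malg k[(W * W)%type]}.
Variables f f' : W -> k.

Definition functional2 : TVTV -> k^o :=
  lext (fun p : W * W => f p.1 *: (f' p.2 : k^o)).

HB.instance Definition _ := GRing.Linear.on functional2.

Lemma functional2_tsr (a b : TV) : functional2 (tsr a b) =
  lext (f : W -> k^o) a * lext (f' : W -> k^o) b.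
Proof. exact: lext_tsrZ. Qed.

Lemma functional2_ideal (I : TV -> Prop) z :
  (forall a, I a -> lext (f : W -> k^o) a = 0) ->
  (forall a, I a -> lext (f' : W -> k^o) a = 0) ->
  tens_ideal I z -> functional2 z = 0.
Proof.
move=> fI f'I [s sI ->]; rewrite linear_sum big_seq big1 //= => p /sI Ip.
by rewrite tensE functional2_tsr; case: Ip => [/fI->|/f'I->]; rewrite ?mul0r ?mulr0.
Qed.

Lemma lext_kill (A : choiceType) (h : A -> k) (a : {malg k[A]}) :
  spanned (fun u => h u = 0) a -> lext (h : A -> k^o) a = 0.
Proof.
move=> ha; rewrite lext_sum big_seq big1 // => u /ha ->; exact: scaler0.
Qed.

End Functional.

(** * Vanishing of Gaussian binomials from a relation in the ideal *)

Lemma add_ltn_subr a b m n n' :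
  (a + b = m -> m < n + n' -> n <= a -> b < n')%N.
Proof. lia. Qed.

Lemma add_leq_ltn_subr a b m n n' :
  (a + b = m -> m <= n + n' -> n < a -> b < n')%N.
Proof. lia. Qed.

Lemma mul_sub_ltn a i j s u :
  (a = i * s + u -> j * s <= a -> i < j -> 0 < s -> a - j * s < u)%N.
Proof.
move=> -> ja ij s0; have : (i * s < j * s)%N by rewrite ltn_mul2r s0.
by move: ja; move: (i * s)%N (j * s)%N; lia.
Qed.

Section Key.
Context {k : fieldType} {disp : Order.disp_t} {X : finOrderType disp}.
Variable c : {linear {malg k[(X * X)%type]} -> {malg k[(X * X)%type]}}.
Variable g : X -> X -> k.
Hypothesis c_tri : left_triangular c g.
Hypothesis c_inj : injective c.
Notation W := {fmonom X}.
Notation TV := {malg k[W]}.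
Variable I : TV -> Prop.
Hypothesis Iideal : two_sided_ideal I.
Hypothesis Icomul : forall a, I a -> tens_ideal I (comul c a).
Implicit Types (s t v : seq X) (u w : W) (a b e : TV) (ls : seq (seq X)).

Lemma lead_size s a : lead s a -> spanned (fun u : W => size u = size s) a.
Proof. by move/lead_perm; apply: sub_spanned => u /perm_size. Qed.

Lemma sgt_catr_eq s t r : size s = size t -> sgt (s ++ r) (t ++ r) -> sgt s t.
Proof.
elim: s t => [|x s IH] [|y t] //=; first by rewrite sgt_irr.
by move=> [st]; case: (y < x)%O => //= /andP[-> /(IH _ st)].
Qed.

Lemma sgt_std_gtF w (s : seq X) :
  sgt w s -> (size w <= size s)%N -> std_gt w (FMonom s).
Proof. by move=> ws ss; apply: sgt_std_gt. Qed.

Lemma lead_eval (h : W -> k) (s : seq X) a : h (FMonom s) = 1 ->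
  (forall w, std_gt w (FMonom s) -> h w = 0) -> lead s a ->
  lext (h : W -> k^o) a = 1.
Proof.
move=> h1 h0 sa; rewrite -(subrK (bas (FMonom s)) a) lextD lextU h1.
rewrite lext_kill ?add0r //; apply: sub_spanned sa => w [ws wgt].
by apply: h0; apply: (sgt_std_gtF wgt); rewrite (perm_size ws).
Qed.

Lemma lead_eval0 (h : W -> k) (s t : seq X) a :
  (forall w, std_gt w (FMonom s) -> h w = 0) -> std_gt (FMonom t) (FMonom s) ->
  lead t a -> lext (h : W -> k^o) a = 0.
Proof.
move=> h0 ts /lead_ge ta; apply: lext_kill; apply: sub_spanned ta => w [wt w_ge].
apply: h0; case: w_ge => [wE|wgt]; first by rewrite -[w]fmK wE.
by apply: std_gt_trans ts; apply: (sgt_std_gtF wgt); rewrite (perm_size wt).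
Qed.

Lemma lead_superwordX ls v n : (forall l, l \in ls -> lyn l) -> lyn v ->
  lead (flatten ls ++ word_pow v n) (superword c ls * super c v ^+ n).
Proof.
move=> lsL vL; apply: lead_mul; first exact: (lead_superword c_tri c_inj lsL).
exact: (@lead_superX _ _ _ _ _ c_tri c_inj v n vL).
Qed.

(* Evaluate the coproduct at v^i (x) w1, where w0 = w1 v^i: minimality of [w0]
   among the words ending in v makes every other word contribute zero. *)
Lemma qbin_vanishes v ls0 n0 i (fac : W -> seq (seq X)) (al : TV) :
  let w0 := FMonom (flatten ls0 ++ word_pow v n0) in
  lyn v -> (0 < i <= n0)%N ->
  (forall l, l \in ls0 -> lyn l /\ sgt_inf v l) ->
  irred I (FMonom (word_pow v i)) ->
  irred I (FMonom (flatten ls0 ++ word_pow v (n0 - i))) ->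
  I (lext (fun w => superword c (fac w)) al) ->
  w0 \in msupp al -> fac w0 = ls0 ++ nseq n0 v ->
  (forall w, w \in msupp al -> [/\ flatten (fac w) = w,
     forall l, l \in fac w -> lyn l, (size w <= size w0)%N &
     size w = size w0 -> exists ls n, [/\ fac w = ls ++ nseq n v,
       forall l, l \in ls -> sgt_inf v l & (0 < n)%N -> w = w0 \/ lexlt w0 w]]) ->
  qbin (gseq g v v) n0 i = 0.
Proof.
move=> w0 vL /andP[i0 in0] ls0P vi_irr u1_irr Ia w0al fw0 alP.
(* [f] and [f'] detect v^i and the word w1 obtained by deleting v^i; both kill [I], so their product
   kills the coproduct of the relation. *)
have [f [fI fv f0]] := irred_functional Iideal vi_irr.
have [f' [f'I f'u f'0]] := irred_functional Iideal u1_irr.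
set u1 := FMonom (_ ++ _) in u1_irr f'u f'0.
set vi := FMonom (word_pow v i) in vi_irr fv f0.
have v0 : (0 < size v)%N by case: (v) vL => // -[].
have fsize a m : (m < size vi)%N -> spanned (fun u : W => size u = m) a ->
    lext (f : W -> k^o) a = 0.
  move=> mv am; apply: lext_kill; apply: sub_spanned am => u um.
  by apply: f0; rewrite std_gtE um mv.
have f'size a m : (m < size u1)%N -> spanned (fun u : W => size u = m) a ->
    lext (f' : W -> k^o) a = 0.
  move=> mv am; apply: lext_kill; apply: sub_spanned am => u um.
  by apply: f'0; rewrite std_gtE um mv.
have size_w0 : (size w0 = size vi + size u1)%N.
  rewrite /w0 /vi /u1 /= !size_cat !size_word_pow addnCA -mulnDl subnKC //.
pose G := functional2 f f'.
have E_size w : w \in msupp al ->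
    spanned (fun u : W => size u = size w) (superword c (fac w)).
  case/alP => fw wL _ _; rewrite -fw; apply: lead_size.
  exact: (lead_superword c_tri c_inj wL).
(* When the total length is too small, one factor is shorter than the word its functional
   detects. *)
have Gsmall w : w \in msupp al -> (size w < size w0)%N ->
    G (delta c (superword c (fac w))) = 0.
  move=> wal ww0; apply: lext_kill.
  apply: sub_spanned (delta_graded (E_size w wal)) => p pw.
  have [p1|p1] := ltnP (size p.1) (size vi).
    by rewrite f0 ?scale0r // std_gtE p1.
  rewrite f'0 ?scaler0 // std_gtE.
  by rewrite (add_ltn_subr pw _ p1) // -size_w0.
(* At full length, comparing lengths leaves only the i-th term of [delta_superword]. *)
have Gbig ls n : (forall l, l \in ls -> lyn l /\ sgt_inf v l) ->
    (size (flatten ls) + n * size v = size w0)%N ->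
    G (delta c (superword c ls * super c v ^+ n)) =
    if (i <= n)%N then qbin (gseq g v v) n i * gseq g (flatten ls) v ^+ i *
      lext (f' : W -> k^o) (superword c ls * super c v ^+ (n - i)) else 0.
  move=> lsP lsn; have dE := delta_superword c_tri c_inj (n := n) vL lsP.
  have vX j : lead (word_pow v j) (super c v ^+ j).
    exact: (@lead_superX _ _ _ _ _ c_tri c_inj v j vL).
  have vsize j : spanned (fun u : W => size u = (j * size v)%N) (super c v ^+ j).
    by rewrite -size_word_pow; apply: lead_size (vX j).
  have Lsize j : (j <= n)%N -> spanned
      (fun u : W => size u = (size w0 - j * size v)%N)
      (superword c ls * super c v ^+ (n - j)).
    move=> jn; have lsL l : l \in ls -> lyn l by case/lsP.
    have := lead_mul (lead_superword c_tri c_inj lsL) (vX (n - j)%N).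
    move/lead_size; rewrite size_cat size_word_pow -lsn mulnBl addnBA //.
    by rewrite leq_mul2r jn orbT.
  move: dE; set S := (\sum_(j < n.+1) _) => dE.
  have Sg : spanned (graded2 (size w0)) S.
    apply: spanned_sum => j _ _; apply: spannedZ.
    have jn : (j <= n)%N by rewrite -ltnS.
    have -> : size w0 = (j * size v + (size w0 - j * size v))%N.
      by rewrite subnKC // -lsn (leq_trans _ (leq_addl _ _)) // leq_mul2r jn orbT.
    exact: tsr_graded (vsize j) (Lsize j jn).
  have Dg : spanned (graded2 (size w0)) (delta c (superword c ls * super c v ^+ n)).
    apply: delta_graded; have := Lsize 0 (leq0n n).
    by rewrite !subn0.
  (* An error tensor has left factor beyond vvv...: if it is no longer than v^i it succeeds v^i and
     [f] kills it, otherwise the right factor is too short for [f']. *)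
  have GR : G (delta c (superword c ls * super c v ^+ n)) = G S.
    apply/eqP; rewrite -subr_eq0 -linearB; apply/eqP; apply: lext_kill => p pR.
    have pinf := dE p pR; have pg : graded2 (size w0) p := spannedB Dg Sg pR.
    have [p1|p1] := leqP (size p.1) (size vi).
      rewrite f0 ?scale0r //; apply: (sgt_std_gt p1).
      by apply: (sgt_inf_size (m := i) pinf); rewrite -size_word_pow; exact: p1.
    rewrite f'0 ?scaler0 // std_gtE.
    by rewrite (add_leq_ltn_subr pg _ p1) // -size_w0.
  rewrite {}GR /S /G linear_sum /=.
  have term (j : 'I_n.+1) : val j != i ->
      G ((qbin (gseq g v v) n j * gseq g (flatten ls) v ^+ j) *:
         tsr (super c v ^+ j) (superword c ls * super c v ^+ (n - j))) = 0.
    move=> ji; rewrite /G linearZ /= functional2_tsr.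
    have [lt_ji|lt_ij|/eqP] := ltngtP (val j) i; last by rewrite (negbTE ji).
      rewrite (fsize _ _ _ (vsize j)) ?mul0r ?scaler0 //.
      by rewrite size_word_pow ltn_mul2r v0 lt_ji.
    have jn : (j <= n)%N by rewrite -ltnS.
    rewrite (f'size _ _ _ (Lsize j jn)) ?mulr0 ?scaler0 //.
    apply: (@mul_sub_ltn _ i _ (size v)) => //.
      by rewrite size_w0 size_word_pow.
    by rewrite -lsn (leq_trans _ (leq_addl _ _)) // leq_mul2r jn orbT.
  case: leqP => [i_n|n_i]; last first.
    rewrite big1 // => j _; apply: term; rewrite neq_ltn.
    by rewrite (leq_trans (ltn_ord j) n_i).
  have i_n1 : (i < n.+1)%N by [].
  rewrite (bigD1 (Ordinal i_n1)) //= big1 ?addr0 => [|j ji]; last exact: term.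
  rewrite /G linearZ /= functional2_tsr (lead_eval fv f0 (vX i)) mul1r.
  by [].
pose coef w := G (delta c (superword c (fac w))).
(* A word other than [w0] is too short, ends in fewer than [i] factors [v], or stays above [u1]
   after v^i is removed. *)
have coef0 w : w \in msupp al -> w <> w0 -> coef w = 0.
  move=> wal ww0; have [fw wL] := alP w wal.
  rewrite leq_eqVlt => /predU1P[sw /(_ sw) [ls [n [fE lsv nw]]]|]; last first.
    by move=> sw _; apply: Gsmall.
  have lsP l : l \in ls -> lyn l /\ sgt_inf v l.
    by move=> lls; split; [apply: wL; rewrite fE mem_cat lls | apply: lsv].
  have wE : w = flatten ls ++ word_pow v n :> seq X.
    by rewrite -fw fE flatten_cat.
  rewrite /coef fE superword_cat superword_nseq Gbig //; last first.
    by rewrite -sw wE size_cat size_word_pow.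
  case: leqP => // i_n; have [//|w0w] := nw (leq_trans i0 i_n).
  rewrite (lead_eval0 f'0 (t := flatten ls ++ word_pow v (n - i))) ?mulr0 //; last first.
    by apply: lead_superwordX vL => l /lsP[].
  have su : size (flatten ls ++ word_pow v (n - i)) = size u1.
    apply: (@addIn (size (word_pow v i))).
    rewrite -size_cat -catA -word_powD subnK // -wE sw size_w0 addnC.
    by [].
  apply: sgt_std_gt; first by rewrite su.
  apply: (@sgt_catr_eq _ _ (word_pow v i)) => //.
  rewrite -!catA -!word_powD !subnK // -wE; apply: lexlt_sgt w0w.
  by rewrite sw.
have coef1 : coef w0 = qbin (gseq g v v) n0 i * gseq g (flatten ls0) v ^+ i.
  rewrite /coef fw0 superword_cat superword_nseq Gbig //; last first.
    by rewrite /w0 /= size_cat size_word_pow.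
  rewrite in0 (lead_eval f'u f'0) ?mulr1 //.
  by apply: lead_superwordX vL => l /ls0P[].
have : G (delta c (lext (fun w => superword c (fac w)) al)) = 0.
  by apply: (functional2_ideal fI f'I); rewrite delta.unlock; apply: Icomul.
have -> : G (delta c (lext (fun w => superword c (fac w)) al)) =
    \sum_(w <- msupp al) al@_w *: coef w.
  rewrite /coef /G lext_sum linear_sum /= linear_sum /=; apply: eq_bigr => w _.
  by rewrite linearZ /= linearZ.
rewrite (big_fsetD1 w0) //= big_seq big1 ?addr0 => [|w]; last first.
  rewrite in_fsetD1 => /andP[/eqP ww0 wal].
  by rewrite -/(coef w) coef0 // scaler0.
rewrite -/(coef w0) coef1 => /eqP; rewrite scaler_eq0 mcoeff_eq0 w0al /= mulf_eq0.
by rewrite expf_eq0 (negbTE (gseq_neq0 c_tri c_inj _ _)) andbF orbF => /eqP.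
Qed.

End Key.

(** * Gauss's formula and the order of q *)

Lemma qbin_prod (R : comPzRingType) (q x y : R) n :
  \prod_(j < n) (x - y * q ^+ j) =
  \sum_(i < n.+1) qbin q n i *
    ((\prod_(j < i) - (q ^+ j)) * y ^+ i * x ^+ (n - i)).
Proof.
elim: n y => [|n IH] y.
  by rewrite big_ord0 big_ord1 big_ord0 qbin0 !expr0 !mulr1.
pose F i : R^o := (\prod_(j < i) - (q ^+ j)) * y ^+ i * x ^+ (n.+1 - i).
rewrite -[RHS]/(\sum_(i < n.+2) qbin q n.+1 i *: F i) qbin_sumS.
rewrite big_ord_recl expr0 mulr1.
(* Removing the factor j = 0 leaves the product for [n] with [y] replaced by [y * q]. *)
under eq_bigr do rewrite exprS mulrA.
rewrite IH mulrBl !mulr_sumr addrC -sumrN.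
congr (_ + _); apply: eq_bigr => i _.
  rewrite -[RHS]/(_ * _) /F big_ord_recr /= subSS exprMn exprS; ring.
rewrite -[RHS]/(_ * _) /F exprMn subSn -1?ltnS // exprS; ring.
Qed.

Lemma rmorph_qbin (R S : pzRingType) (f : {rmorphism R -> S}) q n m :
  f (qbin q n m) = qbin (f q) n m.
Proof.
elim: n m => [|n IH] [|m] /=; rewrite ?rmorph0 ?rmorph1 //.
by rewrite rmorphD rmorphM rmorphXn !IH.
Qed.

Arguments qbin : simpl never.

Section Arithmetic.
Variables (F : fieldType) (q : F) (h : nat).
Hypothesis h_gt1 : (1 < h)%N.
Hypothesis qbin_eq0 : forall i, (0 < i < h)%N -> qbin q h i = 0.

(** In Gauss's formula all inner terms vanish, leaving X^h + c; the factor for j = 0 makes 1 a root,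
    so c = -1. *)
Lemma prod_XsubC_qX : \prod_(j < h) ('X - (q ^+ j)%:P) = 'X^h - 1.
Proof.
have [c Pc] : exists c : F, \prod_(j < h) ('X - (q ^+ j)%:P) = 'X^h + c%:P.
  exists (\prod_(j < h) - (q ^+ j)).
  under eq_bigr do rewrite -[(_ ^+ _)%:P]mul1r rmorphXn.
  rewrite qbin_prod; case: (h) h_gt1 qbin_eq0 => // n _ q0.
  rewrite [LHS]big_ord_recl [X in _ + X = _]big_ord_recr /= big_ord0.
  rewrite [X in _ + (X + _) = _]big1 ?add0r => [|i _]; last first.
    rewrite -(rmorph_qbin polyC) q0 ?mul0r //; exact: (ltn_ord i).
  rewrite -[bump 0 n]/(n.+1) qbin0 qbinn subnn !expr1n !expr0 !mul1r !mulr1 subn0.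
  by rewrite rmorph_prod; congr (_ + _); apply: eq_bigr => i _; rewrite rmorphN rmorphXn.
suff c1 : c = -1 by rewrite Pc c1 rmorphN.
have : ('X^h + c%:P).[1] = 0 :> F.
  rewrite -Pc; case: (h) h_gt1 => // n _; rewrite big_ord_recl hornerM.
  by rewrite !hornerE subrr mul0r.
rewrite !hornerE expr1n => /eqP; rewrite addrC addr_eq0 => /eqP //.
Qed.

(** As h > 1, the factor for j = 1 is present and [q] is a root. *)
Lemma qX_eq1 : q ^+ h = 1.
Proof.
have := congr1 (horner^~ q) prod_XsubC_qX.
rewrite (bigD1 (Ordinal h_gt1)) //= hornerM !hornerE expr1 subrr mul0r.
by move/esym/eqP; rewrite subr_eq0 => /eqP.
Qed.

(** The substitution of X^T is injective, so T = 1 may be assumed. For m > 1 the derivatives at 1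
    are then 0 and m. *)
Lemma XnB1_expr_eq1 T m : (0 < T)%N -> m%:R != 0 :> F ->
  ('X^T - 1) ^+ m = 'X^(T * m) - 1 :> {poly F} -> m = 1.
Proof.
move=> T0 m0 E.
have {}E : ('X - 1) ^+ m = 'X^m - 1 :> {poly F}.
  apply/eqP; rewrite -subr_eq0 -(@comp_poly_eq0 _ _ 'X^T) ?size_polyXn //.
  rewrite comp_polyB rmorphXn /= !rmorphB /= comp_polyX rmorph1 comp_Xn_poly.
  by rewrite E exprM subrr.
case: m m0 E => [|[|m]] //; first by rewrite eqxx.
move=> m0 /(congr1 (fun p => (deriv p).[1])).
rewrite deriv_exp !derivE subr0 mul1r !hornerMn !hornerE subrr exprS mul0r mul0rn.
by rewrite expr1n => /esym/eqP; rewrite (negbTE m0).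
Qed.

Lemma qbin_order t : t.-primitive_root q ->
  ([pchar F] =i pred0 -> q != 1 /\ h = t) /\
  (forall p, p \in [pchar F] -> exists l, h = (t * p ^ l)%N).
Proof.
move=> tq; have t0 := prim_order_gt0 tq.
have /dvdnP[m hE] : (t %| h)%N by rewrite (prim_order_dvd tq) qX_eq1.
have m0 : (0 < m)%N by case: m hE h_gt1 => // ->.
have E : ('X^t - 1) ^+ m = 'X^(t * m) - 1 :> {poly F}.
  (* The h = m t indices split into m blocks of length t, and over each block the factors multiply
     to X^t - 1. *)
  rewrite mulnC -hE -prod_XsubC_qX hE -(factor_Xn_sub_1 tq).
  rewrite -(big_mkord xpredT (fun j => 'X - (q ^+ j)%:P)) big_nat_mul.
  rewrite -[X in _ ^+ X]subn0 -prodr_const_nat; apply: eq_bigr => i _.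
  rewrite -[(i * t)%N]add0n big_addn mulSn addnK; apply: eq_bigr => j _.
  by rewrite exprD [(i * t)%N]mulnC exprM (prim_expr_order tq) expr1n mulr1.
split=> [F0|p pF].
  have m1 : m = 1.
    apply: XnB1_expr_eq1 E => //; rewrite (proj1 (pcharf0P F) F0) -lt0n //.
  have ht : h = t by rewrite hE m1 mul1n.
  (* With q = 1 the order t = h would be 1. *)
  split=> //; apply/eqP => q1; move: h_gt1; rewrite ht.
  by have := prim_order_dvd tq 1; rewrite q1 expr1n eqxx dvdn1 => /eqP ->.
have pp := pcharf_prime pF; exists (logn p m).
have mE : m = (p ^ logn p m * m`_p^')%N by rewrite -p_part partnC.
set T := (t * p ^ logn p m)%N.
have T0 : (0 < T)%N by rewrite muln_gt0 t0 expn_gt0 prime_gt0.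
have : (m`_p^' = 1)%N; last first.
  by move=> m'1; rewrite hE mulnC; congr (_ * _)%N; rewrite {1}mE m'1 muln1.
apply: (XnB1_expr_eq1 T0).
  rewrite -(dvdn_pcharf pF) -p'natE ?part_pnat //.
(* The p-part of [m] is absorbed by Frobenius, so the relation holds with exponent prime to p, which
   must then be 1. *)
rewrite -mulnA -mE -E [in RHS]mE exprM; congr (_ ^+ _).
have pn : [pchar {poly F}].-nat (p ^ logn p m)%N.
  by rewrite pnatX pnatE // pchar_poly pF.
by rewrite exprDn_pchar // exprNn_pchar // expr1n -exprM.
Qed.

End Arithmetic.

(** * Nonincreasing sequences of words *)

Section LyndonSequences.
Context {disp : Order.disp_t} {X : finOrderType disp}.
Implicit Types (s v : seq X) (ls : seq (seq X)).

Lemma sorted_lexge_split v ls :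
  sorted lexge ls -> (forall l, l \in ls -> lexle v l) ->
  exists ls' n, ls = ls' ++ nseq n v /\ forall l, l \in ls' -> lexlt v l.
Proof.
elim: ls => [|l ls IH] lss vP; first by exists [::], 0%N.
have [||ls' [n [lsE ls'P]]] := IH.
- exact: path_sorted lss.
- by move=> t tls; apply: vP; rewrite inE tls orbT.
have := vP l (mem_head _ _); rewrite lexle_eqVlt => /orP[/eqP vl|vl]; last first.
  by exists (l :: ls'), n; split=> [|t]; rewrite ?lsE // inE => /predU1P[->//|/ls'P].
case: ls' => [|l' ls'] in lsE ls'P *; first by exists [::], n.+1; rewrite lsE -vl.
move: lss; rewrite lsE /= => /andP[]; rewrite /lexge -vl lexleNlt.
by rewrite ls'P ?mem_head.
Qed.

Lemma last_lexge_min d ls l :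
  sorted lexge ls -> l \in ls -> lexle (last d ls) l.
Proof.
case: ls => // x ls; elim: ls x l => [|y ls IH] x l /=.
  by rewrite inE => _ /eqP->; rewrite /lexle lexx.
case/andP=> yx ylss; rewrite inE => /predU1P[->|]; last exact: IH.
exact: lexle_trans (IH y y ylss (mem_head _ _)) yx.
Qed.

Lemma sorted_lexge_nseq v n : sorted lexge (nseq n v).
Proof.
case: n => //= n; elim: n => //= n ->; rewrite andbT; exact: lexx.
Qed.

Lemma last_nseq d v n : (0 < n)%N -> last d (nseq n v) = v.
Proof. by case: n => //= n _; elim: n. Qed.

Lemma last_mem d ls : ls <> [::] -> last d ls \in ls.
Proof. by case: ls => // x ls _ /=; apply: mem_last. Qed.

End LyndonSequences.

Lemma scale_bas_inj (k : fieldType) (A : choiceType) (i : A) (x y : k) :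
  x *: bas i = y *: bas i -> x = y.
Proof.
by move/(congr1 (mcoeff i)); rewrite !mcoeffZ mcoeff_bas eqxx !mulr1.
Qed.

(** * The relation at v^h and its extremal word *)

Section Height.
Context {k : fieldType} {disp : Order.disp_t} {X : finOrderType disp}.
Variable c : {linear {malg k[(X * X)%type]} -> {malg k[(X * X)%type]}}.
Variable g : X -> X -> k.
Hypothesis c_tri : left_triangular c g.
Hypothesis c_inj : injective c.
Notation W := {fmonom X}.
Notation TV := {malg k[W]}.
Variable I : TV -> Prop.
Hypothesis Iideal : two_sided_ideal I.
Hypothesis Icomul : forall a, I a -> tens_ideal I (comul c a).

Lemma word_expE (v : W) n : word_exp v n = FMonom (word_pow v n).
Proof.
elim: n => [|n IH]; first by rewrite FMonom_nil.
by rewrite /word_exp iterS -/(word_exp v n) IH word_powS -FMonom_cat fmK.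
Qed.

Lemma qbin_height (v : seq X) h : lyn v -> (0 < h)%N ->
  reducible I (FMonom (word_pow v h)) ->
  (forall j, (j < h)%N -> irred I (FMonom (word_pow v j))) ->
  forall i, (0 < i < h)%N -> qbin (gseq g v v) h i = 0.
Proof.
move=> vL h0 /(reducibleP I) [a agt Ia] v_irr i /andP[i0 ih].
set vh := FMonom (word_pow v h) in agt Ia.
have fac0 (w : W) : exists ls, [/\ flatten ls = w,
    forall l, l \in ls -> lyn l & sorted lexge ls].
  have [||ls [lsE lsP lss]] := @lyn_factor _ X (fun=> True) _ _ w => //.
  by exists ls; split=> // l /lsP[].
(* The factorization is an arbitrary choice except at v^h, where it is prescribed as h copies of
   [v]. *)
pose fac (w : W) := if (w : seq X) == word_pow v h then nseq h v else
  epsilon (inhabits [::]) (fun ls => [/\ flatten ls = w,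
    forall l, l \in ls -> lyn l & sorted lexge ls]).
have facP w : [/\ flatten (fac w) = w,
    forall l, l \in fac w -> lyn l & sorted lexge (fac w)].
  rewrite /fac; case: eqP => [->|_]; last exact: (epsilon_spec _ _ (fac0 w)).
  split=> // [l|]; last exact: sorted_lexge_nseq.
  by rewrite mem_nseq => /andP[_ /eqP->].
have fac_vh : fac vh = nseq h v by rewrite /fac eqxx.
pose E w := superword c (fac w).
have E_lead w : spanned (fun u => std_gt u w) (E w - bas w).
  have [fw wL _] := facP w; have := lead_superword c_tri c_inj wL.
  rewrite /lead fw fmK; apply: sub_spanned => u [uw ugt].
  by apply: sgt_std_gt ugt; rewrite (perm_size uw).
(* v^h is congruent to [a], and [E vh] differs from v^h by greater words; rewriting both excesses
   gives a relation in super-letters headed by v^h. *)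
have [r rP Ir] := reduced_gt Iideal E_lead (spannedD agt (@E_lead vh)).
pose al : TV := bas vh - r.
have Ial : I (lext E al).
  rewrite /al linearB /= lextU.
  have -> : E vh - lext E r = (bas vh - a) + (a + (E vh - bas vh) - lext E r).
    by rewrite addrA addrA subrK addrCA subrr addr0.
  exact: tsiD.
have alP w : w \in msupp al -> w = vh \/ (irred I w /\ std_gt w vh).
  move/(fsubsetP (msuppB_le _ _)); rewrite in_fsetU msupp_bas in_fset1.
  by case/orP => [/eqP|/rP]; [left | right].
have vhal : vh \in msupp al.
  rewrite -mcoeff_neq0 mcoeffB mcoeff_bas eqxx mcoeff_outdom ?subr0 ?oner_eq0 //.
  by apply/negP => /rP[_]; rewrite std_gt_irr.
have size_al w : w \in msupp al -> (size w <= size vh)%N.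
  case/alP => [->//|[_]]; rewrite std_gtE => /orP[/ltnW//|/andP[/eqP->//]].
have v_nil : v <> [::] by case: vL.
have size_vh : (0 < size vh)%N.
  by rewrite size_word_pow muln_gt0 h0; case: (v) v_nil.
(* In a nonincreasing factorization the last factor is the smallest one. *)
pose lf w := last [::] (fac w).
pose S : seq W := [seq w : W <- (msupp al : seq W) | size w == size vh].
have SE w : (w \in S) = (size w == size vh) && (w \in msupp al).
  by rewrite mem_filter.
have vhS : vh \in S by rewrite SE eqxx.
have lf_mem w : w \in S -> lf w \in fac w.
  rewrite SE => /andP[/eqP sw _]; apply: last_mem => fw.
  have [wE _ _] := facP w; move: size_vh; rewrite -sw -wE fw //.
have lf_vh : lf vh = v by rewrite /lf fac_vh last_nseq.
(* Two successive minima single out [w0]: first the least final factor among the words of full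
   length, then the least word ending in it. *)
have [||| v0 v0S v0min] := @list_min _ lexlt [seq lf w | w <- S].
- by move=> t s u; apply: lexlt_trans.
- exact: lexlt_total.
- by move=> SN; move: (map_f lf vhS); rewrite SN.
have v0L : lyn v0.
  by case/mapP: v0S => w wS ->; have [_ wL _] := facP w; apply/wL/lf_mem.
pose S' : seq W := [seq w : W <- S | lf w == v0].
have [||| w0 w0S' w0min] := @list_min _ (fun u w : W => lexlt u w) S'.
- by move=> t s u; apply: lexlt_trans.
- by move=> u w; rewrite fmP; apply: lexlt_total.
- case/mapP: v0S => w wS wv0 SN.
  by have : w \in S'; [rewrite mem_filter -wv0 eqxx | rewrite SN].
have [lw0 w0S] : lf w0 = v0 /\ w0 \in S.
  by move: w0S'; rewrite mem_filter => /andP[/eqP].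
have [/eqP sw0 w0al] : size w0 == size vh /\ w0 \in msupp al.
  by move: w0S; rewrite SE => /andP.
have split_fac w : w \in S -> exists ls n, fac w = ls ++ nseq n v0 /\
    forall l, l \in ls -> lexlt v0 l.
  move=> wS; have [_ _ ws] := facP w; apply: sorted_lexge_split => // l lw.
  apply: lexle_trans (last_lexge_min [::] ws lw); rewrite -/(lf w) lexle_eqVlt.
  by case: (v0min _ (map_f lf wS)) => [->|->]; rewrite ?eqxx ?orbT.
have key w : w \in msupp al -> [/\ flatten (fac w) = w,
     forall l, l \in fac w -> lyn l, (size w <= size w0)%N &
     size w = size w0 -> exists ls n, [/\ fac w = ls ++ nseq n v0,
       forall l, l \in ls -> sgt_inf v0 l & (0 < n)%N -> w = w0 \/ lexlt w0 w]].
  move=> wal; have [fw wL _] := facP w; split=> //; first by rewrite sw0 size_al.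
  move=> sw; have wS : w \in S by rewrite SE sw sw0 eqxx.
  have [ls [n [fE lsP]]] := split_fac w wS; exists ls, n; split=> // [l lls|n0].
    by apply: lyn_sgt_inf (lsP l lls) => //; apply: wL; rewrite fE mem_cat lls.
  apply: w0min; rewrite mem_filter wS andbT /lf fE last_cat last_nseq // eqxx.
(* If the minimal factor is [v], then [w0] is v^h, since the other words of full length are
   lexicographically greater. Minimality of [h] makes v^i and v^(h-i) irreducible. *)
have [v0v|v0v] := eqVneq v0 v.
  have w0vh : w0 = vh.
    have [//|vhw0] : vh = w0 \/ lexlt w0 vh.
      by apply: w0min; rewrite mem_filter lf_vh v0v eqxx.
    have [//|[_]] := alP w0 w0al; rewrite std_gtE sw0 ltnn eqxx /= => w0vh.
    by move: (lexlt_trans vhw0 w0vh); rewrite lexlt_irr.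
  rewrite v0v w0vh in key.
  apply: (@qbin_vanishes _ _ _ c g c_tri c_inj I Iideal Icomul v [::] h i fac al) => //.
  - by rewrite i0 ltnW.
  - exact: v_irr.
  - by apply: v_irr; rewrite ltn_subrL i0 h0.
have w0irr : irred I w0.
  by have [w0vh|[]//] := alP w0 w0al; move: v0v; rewrite -lw0 w0vh lf_vh eqxx.
have [ls0 [n0 [fw0 ls0P]]] := split_fac w0 w0S.
have [w0E w0L _] := facP w0.
have n0_gt0 : (0 < n0)%N.
  case: n0 fw0 => // fw0; have := lf_mem w0 w0S.
  by rewrite fw0 cats0 lw0 => /ls0P; rewrite lexlt_irr.
have {}w0E : w0 = FMonom (flatten ls0 ++ word_pow v0 n0).
  by apply: word_eqP; rewrite -w0E fw0 flatten_cat.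
rewrite w0E in w0al key fw0 w0irr.
(* Otherwise [w0] is irreducible, and with it its prefix and its power of [v0]. Taking i = n0 then
   gives a contradiction, as this binomial is 1. *)
have /eqP : qbin (gseq g v0 v0) n0 n0 = 0.
  apply: (@qbin_vanishes _ _ _ c g c_tri c_inj I Iideal Icomul v0 ls0 n0 n0 fac al) => //.
  - by rewrite n0_gt0 leqnn.
  - move=> l lls; have lL : lyn l by apply: w0L; rewrite w0E fw0 mem_cat lls.
    by split=> //; apply: lyn_sgt_inf (ls0P l lls).
  - by apply: (@irred_cat _ _ _ I Iideal (flatten ls0) _ [::]); rewrite cats0.
  - rewrite subnn cats0.
    exact: (@irred_cat _ _ _ I Iideal [::] _ (word_pow v0 n0)).
by rewrite qbinn oner_eq0.
Qed.

End Height.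

Theorem lemma42 (k : fieldType) (disp : Order.disp_t) (X : finOrderType disp)
    (c : {linear {malg k[(X * X)%type]} -> {malg k[(X * X)%type]}}) (gamma : X -> X -> k)
    (I : {malg k[{fmonom X}]} -> Prop) (v : {fmonom X}) (gvv : k) (h : nat) :
  braiding c ->
  left_triangular c gamma ->
  braided_biideal c I ->
  (exists a, ~ I a) ->
  SI I v ->
  diagT gamma << (v, v) >> = gvv *: << (v, v) >> ->
  height_is I v h ->
  (exists2 m : nat, (0 < m)%N & m.-unity_root gvv) /\
  (forall t : nat, t.-primitive_root gvv ->
     ([pchar k] =i pred0 -> gvv != 1 /\ h = t) /\
     (forall p : nat, p \in [pchar k] -> exists l : nat, h = (t * p ^ l)%N)).
Proof.
move=> [/bij_inj c_inj _] c_tri [Iideal [Icomul _] _] [a0 a0I] [vL v_irr] dvv.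
case=> h_red h_min.
have -> : gvv = gseq gamma v v.
  move: dvv; rewrite /diagT lextE !basE lextU /= basE.
  by move/scale_bas_inj => <-; rewrite /gseq fmK.
have {}vL := lyn_lyndon vL.
(* h = 1 contradicts the choice of [v]. With h = 0, since no word succeeds the empty one, 1 would
   lie in the proper ideal [I]. *)
have h_gt1 : (1 < h)%N.
  case: h h_red {h_min} => [|[|//]] h_red; last first.
    by case: v_irr; move: h_red; rewrite word_expE /word_pow /= cats0 fmK.
  case/(reducibleP I): h_red => b bP Ib; case: a0I.
  suff b0 : b = 0.
    by rewrite -[a0]mulr1 malg1U -[bas mone]subr0 -b0; apply: tsiMl.
  apply/eqP; rewrite -msupp_eq0; apply/negPn/negP => /fset0Pn[w /bP].
  rewrite std_gtE word1 ltn0 /= size_eq0 => /andP[/eqP ->].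
  by rewrite lexlt_irr.
have q0 i : (0 < i < h)%N -> qbin (gseq gamma v v) h i = 0.
  apply: (@qbin_height _ _ _ c gamma c_tri c_inj I Iideal Icomul v h vL (ltnW h_gt1)).
    by rewrite -word_expE.
  by move=> j jh /=; rewrite -word_expE => /h_min; rewrite leqNgt jh.
split; last by move=> t; apply: qbin_order.
exists h; first exact: ltnW.
by apply/unity_rootP; apply: qX_eq1.
Qed.
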